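(* Let $A\in\mathbb{R}^{m\times n}$, $0<\epsilon<1/16$, $\sigma>0$ and an uncertainty set $\mathcal{U}\subset\mathbb{R}^m$ be given, and assume that $A$ satisfies the condition $\mathbf{O}(S,\omega)$ for certain positive integer $S$ and $\omega>0$. Then for every integer $s$ from the range $$1\le s\le\frac{\sigma\sqrt{2S\ln(1/\epsilon)}}{4\omega\|A\|}$$ (where $\|A\|$ is the largest singular value of $A$) there exists a contrast matrix $H=[h_1,\dots,h_n]\in\mathbb{R}^{m\times n}$ satisfying the condition $\mathbf{H}_{s,\infty}(\frac14)$ and such that $$\nu(H)=\max_i\nu(h_i)\le2\sqrt{1+\ln(n)/\ln(1/\epsilon)}\;\omega .$$ Consequently, in this range of values of $s$ one has $\omega_*(\frac1{4s})\le2\sqrt{1+\ln(n)/\ln(1/\epsilon)}\,\omega$, and the regular $\ell_1$-recovery with contrast matrix $H$ and $\rho_i=\nu(h_i)$, as well as the penalized $\ell_1$-recovery with contrast matrix $H$, the given $s$, and $\theta=2$, satisfy, for all $1\le p\le\infty$ and $\upsilon\ge0$, $$\mathrm{Risk}_p(\widehat{x}(\cdot)\,|\,\epsilon,\sigma,s,\upsilon)\le16\,s^{1/p}\left[\omega\sqrt{1+\frac{\ln n}{\ln(1/\epsilon)}}+\frac{\upsilon}{4s}\right].$$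
   Context: Observation model: $y=Ax+u+\sigma\xi\in\mathbb{R}^m$, where $x\in\mathbb{R}^n$ is unknown, $\xi\sim N(0,I_m)$, $\sigma>0$, and $u$ is an unknown nuisance from a known (nonempty) convex compact set $\mathcal{U}\subset\mathbb{R}^m$ symmetric with respect to the origin. Condition $\mathbf{O}(S,\omega)$ on $A$: for every $i\in\{1,\dots,n\}$ and every $S$-element subset $I\ni i$ of $\{1,\dots,n\}$ there exists a routine (Borel function) $\mathcal{R}_{i,I}:\mathbb{R}^m\to\mathbb{R}$ such that for every $x\in\mathbb{R}^n$ supported on $I$ and every $u\in\mathcal{U}$, with $e\sim N(0,I_m)$, $\mathrm{Prob}\{|\mathcal{R}_{i,I}(Ax+u+\sigma e)-x_i|\ge\omega\}\le\epsilon$. $\nu(v)=\sup_{u\in\mathcal{U}}u^Tv+\sigma\sqrt{2\ln(n/\epsilon)}\|v\|_2$, a norm on $\mathbb{R}^m$. Condition $\mathbf{H}_{s,\infty}(\kappa)$ on $H\in\mathbb{R}^{m\times n}$: $\|x\|_\infty\le\|H^TAx\|_\infty+s^{-1}\kappa\|x\|_1$ for all $x\in\mathbb{R}^n$. $\omega_*(\gamma)=\max_{1\le i\le n}\min_{h\in\mathbb{R}^m}\{\nu(h):\|A^Th-e_i\|_\infty\le\gamma\}$, with $e_i$ the $i$-th standard basis vector of $\mathbb{R}^n$ (value $+\infty$ if some of the problems is infeasible). Regular recovery: $\widehat{x}_{\rm reg}(y)\in\mathrm{Argmin}_v\{\|v\|_1:|h_i^T(Av-y)|\le\rho_i,\ 1\le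 i\le n\}$ (value arbitrary for $y$ for which the problem is infeasible). Penalized recovery: $\widehat{x}_{\rm pen}(y)\in\mathrm{Argmin}_v\{\|v\|_1+\theta s\|H^T(Av-y)\|_\infty\}$. Both are taken to be Borel functions of $y$. $x^s$ is obtained from $x$ by zeroing all but the $s$ largest in magnitude entries (ties resolved in favour of smaller indices). $X(s,\upsilon)=\{x\in\mathbb{R}^n:\|x-x^s\|_1\le\upsilon\}$, and $$\mathrm{Risk}_p(\widehat{x}(\cdot)|\epsilon,\sigma,s,\upsilon)=\inf\{\delta:\mathrm{Prob}\{\xi:\exists x\in X(s,\upsilon),u\in\mathcal{U}:\|\widehat{x}(Ax+\sigma\xi+u)-x\|_p>\delta\}\le\epsilon\};$$ equivalently, $\mathrm{Risk}_p\le\delta$ iff there is a set $\Xi$ with $\mathrm{Prob}\{\xi\in\Xi\}\ge1-\epsilon$ such that $\|\widehat{x}(Ax+\sigma\xi+u)-x\|_p\le\delta$ for all $\xi\in\Xi$, $x\in X(s,\upsilon)$, $u\in\mathcal{U}$.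
   Formalization: The formal statement assumes in addition S ≤ n: for S > n there are no S-element subsets of {1,…,n}, so condition O(S,ω) holds vacuously and the claim fails (e.g. m=n=1, A=1, σ=1, U={0}, ε=1/20, S=2, ω=0.1, s=1). *)

(* Defs.v *)
From HB Require Import structures.
From mathcomp Require Import all_boot all_order all_algebra.
From mathcomp Require Import all_classical all_reals all_analysis.

Set Implicit Arguments.
Unset Strict Implicit.
Unset Printing Implicit Defensive.

Import Order.TTheory GRing.Theory Num.Theory.
Import numFieldNormedType.Exports.

Local Open Scope classical_set_scope.
Local Open Scope ring_scope.

Definition borel_fun (T U : ptopologicalType) (f : T -> U) : Prop :=
  measurable_fun [set: g_sigma_algebraType (@open T)]
    (f : g_sigma_algebraType (@open T) -> g_sigma_algebraType (@open U)).

Section gaussian.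
Context {R : realType}.

Definition tuple_cons (m : nat)
    (p : measurableTypeR R * m.-tuple (measurableTypeR R)) :
  m.+1.-tuple (measurableTypeR R) := [tuple of p.1 :: p.2].

Lemma measurable_tuple_cons m : measurable_fun setT (@tuple_cons m).
Proof. exact: measurable_cons. Qed.

HB.instance Definition _ m :=
  isMeasurableFun.Build _ _ _ _ (@tuple_cons m) (@measurable_tuple_cons m).

(* N(0, I_m) as the m-fold product of N(0, 1): the coordinates are added one
   at a time by pushing a binary product measure forward. *)
Fixpoint std_gaussian (m : nat) :
    probability (m.-tuple (measurableTypeR R)) R :=
  match m with
  | 0 => dirac [tuple]
  | k.+1 => distribution
              (product_measure1 (normal_prob (0 : R) 1) (std_gaussian k))
              (@tuple_cons k)
  end.

Definition tuple_col (m : nat) (t : m.-tuple (measurableTypeR R)) : 'cV[R]_m :=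
  \col_i (tnth t i : R).

(* Prob{xi \in E} for xi ~ N(0, I_m). The outer extension agrees with the
   measure itself on measurable sets; it is needed because the event in the
   definition of the risk, an existential quantification over uncountably many
   signals and nuisances, need not be a Borel set. *)
Definition Prob_gauss (m : nat) (E : set 'cV[R]_m) : \bar R :=
  mu_ext (std_gaussian m) (@tuple_col m @^-1` E).

End gaussian.

Section vectors.
Context {R : realType}.

Definition lpnorm (n : nat) (p : \bar R) (v : 'cV[R]_n) : R :=
  match p with
  | p'%:E => (\sum_i `|v i ord0| `^ p') `^ p'^-1
  | +oo%E => `|v|
  | -oo%E => 0
  end.

Definition dotp (n : nat) (u v : 'cV[R]_n) : R := \sum_i u i ord0 * v i ord0.

Definition basis_vec (n : nat) (i : 'I_n) : 'cV[R]_n := delta_mx i ord0.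

(* Singular values are the nonnegative t such that t ^+ 2 is an eigenvalue of
   A^T A. *)
Definition max_singular_value (m n : nat) (A : 'M[R]_(m, n)) : R :=
  sup [set t : R | 0 <= t /\ eigenvalue (A^T *m A) (t ^+ 2)].

(* x^s: entry i is kept iff fewer than s indices precede i when the entries
   are sorted by decreasing magnitude, smaller index first in case of ties. *)
Definition top_entries (n s : nat) (x : 'cV[R]_n) : 'cV[R]_n :=
  \col_i (if (#|[pred j : 'I_n | (`|x i ord0| < `|x j ord0|)%R
                  || (`|x j ord0| == `|x i ord0|)%R && (j < i)%N]| < s)%N
          then x i ord0 else 0).

Definition near_sparse (n s : nat) (upsilon : R) : set 'cV[R]_n :=
  [set x | lpnorm 1 (x - top_entries s x) <= upsilon].

Definition supported (n : nat) (I : {set 'I_n}) (x : 'cV[R]_n) : Prop :=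
  forall j, j \notin I -> x j ord0 = 0.

Definition argmin (T : Type) (D : set T) (f : T -> R) : set T :=
  [set v | D v /\ forall w, D w -> f v <= f w].

End vectors.

Section model.
Context {R : realType}.
Variables (m n : nat).
Implicit Types (A H : 'M[R]_(m, n)) (U : set 'cV[R]_m) (eps sigma : R).

Definition uncertainty_set U : Prop :=
  [/\ U !=set0, convex_set U, compact U & forall u, U u -> U (- u)].

Definition condO A U sigma eps (S : nat) (omega : R) : Prop :=
  forall (i : 'I_n) (I : {set 'I_n}), #|I| = S -> i \in I ->
  exists2 rout : 'cV[R]_m -> R, borel_fun rout &
    forall x u, supported I x -> U u ->
      (Prob_gauss [set e | (omega <=
          `|rout (A *m x + u + sigma *: e) - x i ord0|)%R] <= eps%:E)%E.

Definition nu U sigma eps (v : 'cV[R]_m) : R :=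
  sup [set dotp u v | u in U]
  + sigma * Num.sqrt (2 * ln (n%:R / eps)) * lpnorm 2%:E v.

Definition nu_mx U sigma eps H : R :=
  \big[Num.max/0]_i nu U sigma eps (col i H).

Definition condH A (s : nat) (kappa : R) H : Prop :=
  forall x : 'cV[R]_n,
    lpnorm +oo x <= lpnorm +oo (H^T *m A *m x)
                    + s%:R^-1 * kappa * lpnorm 1 x.

(* The infimum over an empty set is +oo, as wanted for infeasible problems. *)
Definition omega_star A U sigma eps (gamma : R) : \bar R :=
  \big[maxe/-oo%E]_(i < n)
    ereal_inf [set (nu U sigma eps h)%:E | h in
      [set h : 'cV[R]_m | lpnorm +oo (A^T *m h - basis_vec i) <= gamma]].

Definition regular_feasible A H (rho : 'I_n -> R) (y : 'cV[R]_m) :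
    set 'cV[R]_n :=
  [set v | forall i, `|dotp (col i H) (A *m v - y)| <= rho i].

Definition regular_recovery A H (rho : 'I_n -> R)
    (xhat : 'cV[R]_m -> 'cV[R]_n) : Prop :=
  borel_fun xhat /\
  forall y, regular_feasible A H rho y !=set0 ->
    argmin (regular_feasible A H rho y) (lpnorm 1) (xhat y).

Definition penalized_recovery A H (s : nat) (theta : R)
    (xhat : 'cV[R]_m -> 'cV[R]_n) : Prop :=
  borel_fun xhat /\
  forall y, argmin setT
    (fun v => lpnorm 1 v + theta * s%:R * lpnorm +oo (H^T *m (A *m v - y)))
    (xhat y).

Definition risk A U (p : \bar R) (xhat : 'cV[R]_m -> 'cV[R]_n)
    eps sigma (s : nat) (upsilon : R) : \bar R :=
  ereal_inf [set delta%:E | delta in [set delta : R |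
    (Prob_gauss [set xi | exists x u, [/\ near_sparse s upsilon x, U u &
       (delta < lpnorm p (xhat (A *m x + sigma *: xi + u) - x))%R]]
     <= eps%:E)%E]].

End model.

Arguments nu {R m} n U sigma eps v.

(* Main.v *)
From HB Require Import structures.
Require Import Defs.
From mathcomp Require Import all_boot all_order all_algebra.
From mathcomp Require Import all_classical all_reals all_analysis.
From mathcomp Require Import measurable_realfun ring lra.

(** Why the theorem holds. A routine accurate to omega on the signals supported
    on a set I of size S tells the mean A x + u from its opposite whenever
    x_i >= omega, with both errors at most eps. Two Gaussian laws can be told
    apart only if their means are distant, so the convex set of the vectors
    A x + u with x supported on I and x_i = omega stays at distance
    c0 = sigma sqrt (ln (1 / eps) / 2) from 0 (condO_separated). A hyperplane
    separating it from that ball is a contrast h (contrast_on_support): A^T h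
    equals e_i on I, and the bias of h over U plus c0 |h| is at most omega.

    Such an h depends on I and is uncontrolled outside of I, except that
    |A^T h| <= |A| |h|. A single contrast for i is obtained by convex duality
    (contrast_exists). Against a test vector z take for I the index i and the
    S - 1 largest other entries of z: on the complement of I both z, by
    l2_tail_le, and A^T h, by contrast_image_bound and the range allowed for s,
    have small Euclidean norm, so that <z, A^T h - e_i> < |z|_1 / (4 s)
    for z != 0. Separating hyperplanes then yield one h with
    |A^T h - e_i|_oo <= 1 / (4 s), and this h still satisfies the bound on bias
    plus c0 |h|, since that bound is convex in h.

    The columns h_i give condH with constant 1 / 4 and the bound on nu
    (contrast_condH, admissible_nu). For the risk, the Gaussian tail bound
    expR (- t^2 / 2) with constant 1 and a union bound over the n columns show
    that |h_i^T (u + sigma xi)| <= nu(h_i) for all i and all u at once, outside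
    an event of probability eps (noise_event). On the rest, comparing the
    recovery with the true signal bounds the l1 and the sup norm of the error
    (recovery_error), and the lp norms interpolate between the two.

    The Gaussian facts, the two-point test and the tail, both come from the
    Cameron-Martin formula for the measure std_gaussian. *)

Set Implicit Arguments.
Unset Strict Implicit.
Unset Printing Implicit Defensive.

Import Order.TTheory GRing.Theory Num.Theory.
Import numFieldNormedType.Exports.

Local Open Scope classical_set_scope.
Local Open Scope ring_scope.

(** * Translations of the standard Gaussian measure *)

Section density.
Local Open Scope ereal_scope.
Context d (T : measurableType d) (R : realType).
Variables (mu nu : {measure set T -> \bar R}) (g : T -> R).
Hypotheses (mg : measurable_fun setT g) (g0 : forall x, (0 <= g x)%R).
Hypothesis nuE : forall A, measurable A -> nu A = \int[mu]_(x in A) (g x)%:E.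

Import HBNNSimple.

Let mgE : measurable_fun setT (fun x => (g x)%:E).
Proof. exact/measurable_EFinP. Qed.

Let integral_density_nnsfun (h : {nnsfun T >-> R}) :
  \int[nu]_x (h x)%:E = \int[mu]_x ((h x)%:E * (g x)%:E).
Proof.
under [LHS]eq_integral do rewrite fimfunE -fsumEFin//.
rewrite [LHS]ge0_integral_fsum//; last 2 first.
  - by move=> r; exact/measurable_EFinP/measurableT_comp.
  - by move=> n x _; rewrite EFinM nnfun_muleindic_ge0.
under [RHS]eq_integral.
  move=> x xD; rewrite fimfunE -fsumEFin// ge0_mule_fsuml; last first.
    by move=> r; exact: nnfun_muleindic_ge0.
  over.
rewrite [RHS]ge0_integral_fsum//; last 2 first.
  - move=> r; apply: emeasurable_funM => //.
    by apply/measurable_EFinP; apply/measurableT_comp.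
  - by move=> n x _; apply: mule_ge0; rewrite ?nnfun_muleindic_ge0 ?lee_fin.
apply: eq_fsbigr => r /[!inE] -[x _ hxr].
have r0 : (0 <= r)%R by rewrite -hxr.
have mr : measurable (h @^-1` [set r]) by exact: measurable_sfunP.
under eq_integral do rewrite EFinM.
rewrite ge0_integralZl//; last exact/measurable_EFinP/measurable_indic.
rewrite integral_indic// setIT nuE//.
under [RHS]eq_integral do rewrite EFinM -muleA.
rewrite ge0_integralZl//; last 2 first.
  - by apply: emeasurable_funM => //; apply/measurable_EFinP; apply: measurable_indic.
  - by move=> y _; rewrite mule_ge0// lee_fin.
congr (_ * _).
rewrite integral_mkcond; apply: eq_integral => y _.
by rewrite patchE indicE; case: ifPn; rewrite ?mul1e ?mul0e.
Qed.

(** By monotone convergence from simple functions, so that f need not be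
    integrable. *)
Lemma ge0_integral_density (f : T -> \bar R) :
  measurable_fun setT f -> (forall x, 0 <= f x) ->
  \int[nu]_x f x = \int[mu]_x (f x * (g x)%:E).
Proof.
move=> mf f0.
pose f_ := nnsfun_approx measurableT mf.
have f_cvg x : EFin \o f_ ^~ x @ \oo --> f x by exact: cvg_nnsfun_approx.
transitivity (limn (fun n => \int[nu]_x (f_ n x)%:E)).
  rewrite -monotone_convergence//=.
  - by apply: eq_integral => x _; apply/esym/cvg_lim => //; exact: f_cvg.
  - by move=> n; exact/measurable_EFinP/measurable_funTS.
  - by move=> n ? _; rewrite lee_fin.
  - by move=> ? _ ? ? mn; rewrite lee_fin; exact/lefP/nd_nnsfun_approx.
transitivity (limn (fun n => \int[mu]_x ((f_ n x)%:E * (g x)%:E))).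
  by apply: congr_lim; apply/funext => n; exact: integral_density_nnsfun.
rewrite -monotone_convergence//=.
- apply: eq_integral => x _; apply/cvg_lim => //.
  by apply: cvgeZr => //; exact: f_cvg.
- move=> n; apply: emeasurable_funM => //.
  exact/measurable_EFinP/measurable_funTS.
- by move=> n x _; rewrite -EFinM lee_fin mulr_ge0.
- move=> x _ a b ab; rewrite lee_wpmul2r ?lee_fin//.
  exact/lefP/nd_nnsfun_approx.
Qed.

End density.

Section normal1.
Local Open Scope ereal_scope.
Context {R : realType}.
Local Notation mu := (@lebesgue_measure R).

Lemma measurable_shift (c : R) : measurable_fun setT
  ((fun x => x + c)%R : measurableTypeR R -> measurableTypeR R).
Proof. exact: measurable_funD. Qed.

Lemma lebesgue_measure_shift (c : R) (A : set R) : measurable A ->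
  pushforward mu ((fun x => x + c)%R : measurableTypeR R -> measurableTypeR R) A
  = mu A.
Proof.
move=> mA.
pose f : {mfun _ >-> _} := HB.pack
  ((fun x => x + c)%R : measurableTypeR R -> measurableTypeR R)
  (isMeasurableFun.Build _ _ _ _ _ (measurable_shift c)).
apply/esym/(@lebesgue_measure_unique _ (pushforward mu f)) => //= _ [[a b]] _ <-.
rewrite /pushforward/=.
rewrite (_ : _ @^-1` _ = `](a - c)%R, (b - c)%R]%classic); last first.
  by apply/seteqP; split => x /=; rewrite !in_itv/= ltrBlDr lerBrDr.
rewrite !lebesgue_measure_itv/= !lte_fin ltrD2r; case: ifP => // _.
by rewrite -!EFinB; congr (_%:E); ring.
Qed.

Lemma ge0_integral_lebesgue_shift (c : R) (f : measurableTypeR R -> \bar R) :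
  measurable_fun setT f -> (forall x, 0 <= f x) ->
  \int[mu]_x f (x + c)%R = \int[mu]_x f x.
Proof.
move=> mf f0.
have := @ge0_integral_pushforward _ _ _ _ R _ (measurable_shift c) mu setT f
  measurableT mf (fun x _ => f0 x).
rewrite preimage_setT => /= <-.
apply: eq_measure_integral => [|mS A mA _]; first exact: measurable_shift.
exact: lebesgue_measure_shift.
Qed.

Local Notation phi := (normal_pdf (0 : R) 1).
Local Notation N01 := (normal_prob (0 : R) 1).

Lemma phiE (x : R) :
  phi x = (normal_peak 1 * expR (- (x ^+ 2 / 2)))%R.
Proof.
by rewrite normal_pdfE ?oner_neq0// /normal_fun subr0 expr1n mulNr.
Qed.

Lemma ge0_integral_normal (f : measurableTypeR R -> \bar R) :
  measurable_fun setT f -> (forall x, 0 <= f x) ->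
  \int[N01]_x f x = \int[mu]_x (f x * (phi x)%:E).
Proof.
move=> mf f0; apply: ge0_integral_density => //.
- exact: measurable_normal_pdf.
- by move=> x; exact: normal_pdf_ge0.
Qed.

Lemma ge0_integral_normal_shift (c : R) (f : measurableTypeR R -> \bar R) :
  measurable_fun setT f -> (forall x, 0 <= f x) ->
  \int[N01]_x f (x + c)%R =
  \int[N01]_x (f x * (expR (c * x - c ^+ 2 / 2))%:E).
Proof.
move=> mf f0.
have mexp : measurable_fun setT
    (fun x : measurableTypeR R => (expR (c * x - c ^+ 2 / 2))%:E).
  apply/measurable_EFinP; apply: measurableT_comp => //.
  by apply: measurable_funB => //; apply: measurable_funM.
have mphi : measurable_fun setT (fun x : measurableTypeR R => (phi x)%:E).
  by apply/measurable_EFinP; exact: measurable_normal_pdf.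
rewrite ge0_integral_normal; last 2 first.
- by apply: measurableT_comp mf _; exact: measurable_shift.
- by move=> x; exact: f0.
rewrite ge0_integral_normal; last 2 first.
- exact: emeasurable_funM.
- by move=> x; rewrite mule_ge0// lee_fin expR_ge0.
rewrite -[RHS](@ge0_integral_lebesgue_shift c); last 2 first.
- by apply: emeasurable_funM => //; exact: emeasurable_funM.
- by move=> x; rewrite !mule_ge0// lee_fin ?expR_ge0 ?normal_pdf_ge0.
apply: eq_integral => x _.
rewrite -muleA -EFinM; congr (_ * (_)%:E).
rewrite !phiE mulrCA -expRD; congr (_ * expR _)%R.
by field.
Qed.

End normal1.

Section std_gaussian.
Local Open Scope ereal_scope.
Context {R : realType}.

Lemma ge0_integral_std_gaussianS m (f : m.+1.-tuple (measurableTypeR R) -> \bar R) :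
  measurable_fun setT f -> (forall x, 0 <= f x) ->
  \int[std_gaussian m.+1]_t f t =
  \int[normal_prob (0 : R) 1]_x \int[std_gaussian m]_t f (tuple_cons (x, t)).
Proof.
move=> mf f0.
rewrite ge0_integral_distribution//.
rewrite fubini_tonelli1//; last by move=> x; exact: f0.
by apply: measurableT_comp mf _.
Qed.

Definition shift_tuple m (c : 'I_m -> R) (t : m.-tuple (measurableTypeR R)) :
  m.-tuple (measurableTypeR R) := [tuple (tnth t i + c i)%R | i < m].

Lemma measurable_shift_tuple m (c : 'I_m -> R) :
  measurable_fun setT (shift_tuple c).
Proof.
apply/measurable_fun_tnthP => i.
rewrite (_ : _ \o _ = fun t => (tnth t i + c i)%R); last first.
  by apply/funext => t /=; rewrite tnth_mktuple.
by apply: measurable_funD => //; exact: measurable_tnth.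
Qed.

Lemma shift_tuple_cons m (c : 'I_m.+1 -> R) x (t : m.-tuple (measurableTypeR R)) :
  shift_tuple c (tuple_cons (x, t)) =
  tuple_cons ((x + c ord0)%R, shift_tuple (c \o lift ord0) t).
Proof.
apply: eq_from_tnth => i; rewrite tnth_mktuple.
case: (unliftP ord0 i) => [j ->|->]; last by rewrite !tnth0.
by rewrite !tnthS tnth_mktuple.
Qed.

Lemma measurable_slice m (f : m.+1.-tuple (measurableTypeR R) -> \bar R) x :
  measurable_fun setT f ->
  measurable_fun setT (fun t => f (tuple_cons (x, t))).
Proof.
move=> mf; apply: measurableT_comp mf _.
by apply: measurableT_comp => //; exact: measurable_tuple_cons.
Qed.

Lemma measurable_slice_integral m
    (f : m.+1.-tuple (measurableTypeR R) -> \bar R) :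
  measurable_fun setT f -> (forall t, 0 <= f t) ->
  measurable_fun setT
    (fun x => \int[std_gaussian m]_t f (tuple_cons (x, t))).
Proof.
move=> mf f0.
apply: (@measurable_fun_fubini_tonelli_F _ _ _ _ _ _ (f \o @tuple_cons R m)).
  by apply: measurableT_comp mf _.
by move=> x; exact: f0.
Qed.

(** The likelihood ratio of N(c, I_m) with respect to N(0, I_m). *)
Definition shift_density m (c : 'I_m -> R) (t : m.-tuple (measurableTypeR R))
  : R := expR (\sum_i (c i * tnth t i - c i ^+ 2 / 2)).

Lemma measurable_shift_density m (c : 'I_m -> R) :
  measurable_fun setT (shift_density c).
Proof.
apply: measurableT_comp => //.
apply: measurable_sum => i; apply: measurable_funB => //.
by apply: measurable_funM => //; exact: measurable_tnth.
Qed.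

(** Induction on m: Tonelli peels off one coordinate, on which the claim is the
    one-dimensional change of variable, and densities multiply. *)
Lemma cameron_martin m (c : 'I_m -> R)
    (f : m.-tuple (measurableTypeR R) -> \bar R) :
  measurable_fun setT f -> (forall t, 0 <= f t) ->
  \int[std_gaussian m]_t f (shift_tuple c t) =
  \int[std_gaussian m]_t (f t * (shift_density c t)%:E).
Proof.
elim: m c f => [|m IHm] c f mf f0.
  apply: eq_integral => t _; rewrite /shift_density big_ord0 expR0 mule1.
  by congr (f _); apply: eq_from_tnth => -[].
have mfs : measurable_fun setT (fun t => f (shift_tuple c t)).
  by apply: measurableT_comp mf _; exact: measurable_shift_tuple.
have md : measurable_fun setT (fun t => (shift_density c t)%:E).
  by apply/measurable_EFinP; exact: measurable_shift_density.
rewrite ge0_integral_std_gaussianS//.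
rewrite ge0_integral_std_gaussianS; last 2 first.
- exact: emeasurable_funM.
- by move=> t; rewrite mule_ge0// lee_fin expR_ge0.
pose F x := \int[std_gaussian m]_t
  (f (tuple_cons (x, t)) * (shift_density (c \o lift ord0) t)%:E).
transitivity (\int[normal_prob (0 : R) 1]_x F (x + c ord0)%R).
  apply: eq_integral => x _.
  rewrite /F -(IHm _ (fun t => f (tuple_cons ((x + c ord0)%R, t)))) //.
    by apply: eq_integral => t _; rewrite shift_tuple_cons.
  exact: measurable_slice.
rewrite ge0_integral_normal_shift; last 2 first.
- have mh : measurable_fun setT (fun t : m.+1.-tuple (measurableTypeR R) =>
      f t * (shift_density (c \o lift ord0) [tuple of behead t])%:E).
    apply: emeasurable_funM => //; apply/measurable_EFinP.
    apply: measurableT_comp; first exact: measurable_shift_density.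
    exact: measurable_behead.
  rewrite (_ : F = fun x => \int[std_gaussian m]_t (fun t => f t *
      (shift_density (c \o lift ord0) [tuple of behead t])%:E)
      (tuple_cons (x, t))).
    apply: (measurable_slice_integral mh) => t.
    by rewrite mule_ge0// lee_fin expR_ge0.
  apply/funext => x; apply: eq_integral => t _ /=.
  by congr (_ * (shift_density _ _)%:E); apply: val_inj.
- move=> x; apply: integral_ge0 => t _.
  by rewrite mule_ge0// lee_fin expR_ge0.
apply: eq_integral => x _.
rewrite /F muleC -ge0_integralZl//; last 2 first.
- apply: emeasurable_funM; first exact: measurable_slice.
  by apply/measurable_EFinP; exact: measurable_shift_density.
- by move=> t _; rewrite mule_ge0// lee_fin expR_ge0.
apply: eq_integral => t _.
rewrite muleCA -EFinM /shift_density -expRD big_ord_recl tnth0.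
congr (_ * (expR (_ + _))%:E).
by apply: eq_bigr => i _; rewrite tnthS.
Qed.

End std_gaussian.

(** * Two-point tests and Gaussian tails *)

Section gauss_ineq.
Local Open Scope ereal_scope.
Context {R : realType}.
Variable m : nat.
Local Notation gauss := (@std_gaussian R m).
Local Notation T := (m.-tuple (measurableTypeR R)).

Lemma std_gaussian_shiftE (c : 'I_m -> R) (E : set T) : measurable E ->
  gauss (shift_tuple c @^-1` E) =
  \int[gauss]_t ((\1_E t)%:E * (shift_density c t)%:E).
Proof.
move=> mE.
have mS : measurable (shift_tuple c @^-1` E).
  by rewrite -[X in measurable X]setTI; exact: measurable_shift_tuple.
rewrite -[X in gauss X = _]setIT -integral_indic//.
by rewrite -(cameron_martin _ (f := fun t => (\1_E t)%:E))//; exact/measurable_EFinP/measurable_indic.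
Qed.

Let shift_densityMN (c : 'I_m -> R) t :
  (shift_density c t * shift_density (fun i => - c i) t =
   expR (- (\sum_i c i ^+ 2)))%R.
Proof.
rewrite -expRD -big_split/= -sumrN; congr expR.
by apply: eq_bigr => i _; field.
Qed.

(** The left-hand weight is the geometric mean of the likelihood ratios of
    N(c, I) and N(-c, I), whose product is constant; it is at most any weighted
    arithmetic mean of the two. *)
Lemma std_gaussian_shift_amgm (c : 'I_m -> R) (a : R) (E : set T) :
  (0 < a)%R -> measurable E ->
  (expR (- (\sum_i c i ^+ 2) / 2))%:E * gauss E <=
  (a / 2)%:E * gauss (shift_tuple c @^-1` E) +
  (a^-1 / 2)%:E * gauss (shift_tuple (fun i => - c i)%R @^-1` E).
Proof.
move=> a0 mE.
have mD (b : 'I_m -> R) : measurable_fun setT (fun t => (shift_density b t)%:E).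
  by apply/measurable_EFinP; exact: measurable_shift_density.
have m1 : measurable_fun setT (fun t : T => (\1_E t)%:E : \bar R).
  exact/measurable_EFinP/measurable_indic.
have D0 (b : 'I_m -> R) t : 0 <= (\1_E t)%:E * (shift_density b t)%:E.
  by rewrite mule_ge0// lee_fin expR_ge0.
rewrite !std_gaussian_shiftE// -[X in gauss X]setIT -integral_indic//.
rewrite -!ge0_integralZl//; first last.
- by rewrite lee_fin divr_ge0// ltW.
- exact: emeasurable_funM.
- by rewrite lee_fin divr_ge0// invr_ge0 ltW.
- exact: emeasurable_funM.
rewrite -ge0_integralD//; first last.
- by apply: emeasurable_funM => //; exact: emeasurable_funM.
- by move=> t _; rewrite mule_ge0// lee_fin divr_ge0// invr_ge0 ltW.
- by apply: emeasurable_funM => //; exact: emeasurable_funM.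
- by move=> t _; rewrite mule_ge0// lee_fin divr_ge0// ltW.
apply: ge0_le_integral => //.
- exact: emeasurable_funM.
- by apply: emeasurable_funD; apply: emeasurable_funM => //; exact: emeasurable_funM.
move=> t _; rewrite -!EFinM -EFinD lee_fin.
have := shift_densityMN c t.
set x := shift_density c t; set y := shift_density _ t => xy.
set q := expR _.
have qq : (q ^+ 2 = x * y)%R by rewrite xy /q -expRM_natl; congr expR; field.
rewrite (_ : _ + _ = \1_E t * ((a * x + a^-1 * y) / 2))%R; last by ring.
rewrite mulrC ler_wpM2l//.
have x0 : (0 < x)%R by exact: expR_gt0.
have y0 : (0 < y)%R by exact: expR_gt0.
have s0 : (0 <= (a * x + a^-1 * y) / 2)%R.
  by rewrite divr_ge0// addr_ge0// mulr_ge0// ?invr_ge0 ltW.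
rewrite -(@ler_pXn2r _ 2)// ?nnegrE ?expR_ge0// qq.
rewrite -subr_ge0 (_ : _ - _ = ((a * x - a^-1 * y) / 2) ^+ 2)%R ?sqr_ge0//.
by field; rewrite gt_eqF.
Qed.

Lemma mu_ext_cover (F : set T) (e d : R) :
  mu_ext gauss F <= e%:E -> (0 < d)%R ->
  exists E, [/\ measurable E, F `<=` E & gauss E <= (e + d)%:E].
Proof.
move=> Fe d0.
have : mu_ext gauss F < (e + d)%:E.
  by rewrite (le_lt_trans Fe)// lte_fin ltrDl.
move=> /ereal_inf_lt [_ [A [mA FA] <-] Ad].
exists (\bigcup_k A k); split => //; first exact: bigcupT_measurable.
apply: le_trans (ltW Ad).
by apply: measure_sigma_subadditive => //; exact: bigcupT_measurable.
Qed.

(** N(c, I) and N(-c, I) cannot be told apart with both error probabilities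
    below eps unless c is long: the affinity expR (- |c|^2 / 2) of the two laws
    is split over the two rejection events, and on each of them
    std_gaussian_shift_amgm bounds it by sqrt eps. The error events F1 and F2
    are arbitrary sets, measured from outside, so that nothing is asked of the
    decision rule. *)
Lemma test_separation (c : 'I_m -> R) (eps : R) (F1 F2 : set T) :
  (0 < eps)%R ->
  mu_ext gauss F1 <= eps%:E -> mu_ext gauss F2 <= eps%:E ->
  (forall t, F1 (shift_tuple (fun i => - c i)%R t) \/ F2 (shift_tuple c t)) ->
  (expR (- \sum_i c i ^+ 2) <= 4 * eps)%R.
Proof.
move=> eps0 F1e F2e F12; apply/ler_addgt0Pr => d d0.
have d4 : (0 < d / 4)%R by rewrite divr_gt0.
have [E1 [mE1 FE1 E1e]] := mu_ext_cover F1e d4.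
have [E2 [mE2 FE2 E2e]] := mu_ext_cover F2e d4.
set c' := (fun i => - c i)%R in F12.
pose E := shift_tuple c' @^-1` E1; pose E' := shift_tuple c @^-1` E2.
have mE : measurable E.
  by rewrite -[X in measurable X]setTI; exact: measurable_shift_tuple.
have mE' : measurable E'.
  by rewrite -[X in measurable X]setTI; exact: measurable_shift_tuple.
have shiftK (b b' : 'I_m -> R) (t : T) : (forall i, b i = - b' i)%R ->
    shift_tuple b (shift_tuple b' t) = t.
  move=> bb; apply: eq_from_tnth => i.
  by rewrite !tnth_mktuple bb addrK.
set e := (eps + d / 4)%R in E1e E2e.
have e0 : (0 < e)%R by rewrite addr_gt0.
(* this weight minimizes the final bound a e + 1 / a *)
pose a := ((Num.sqrt e)^-1)%R.
have a0 : (0 < a)%R by rewrite invr_gt0 sqrtr_gt0.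
have := std_gaussian_shift_amgm c a0 mE.
have := std_gaussian_shift_amgm c' a0 mE'.
rewrite (_ : shift_tuple c @^-1` E = E1); last first.
  by apply/seteqP; split => t; rewrite /E/= shiftK// => i; rewrite /c' opprK.
rewrite (_ : shift_tuple c' @^-1` E' = E2); last first.
  by apply/seteqP; split => t; rewrite /E'/= shiftK// => i; rewrite /c' opprK.
rewrite (_ : (fun i => - c' i)%R = c); last first.
  by apply/funext => i; rewrite /c' opprK.
rewrite (_ : \sum_i c' i ^+ 2 = \sum_i c i ^+ 2)%R; last first.
  by apply: eq_bigr => i _; rewrite /c' sqrrN.
set X := shift_tuple c' @^-1` E; set X' := shift_tuple c @^-1` E'.
have mX : measurable X.
  by rewrite -[X in measurable X]setTI; exact: measurable_shift_tuple.
have mX' : measurable X'.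
  by rewrite -[X in measurable X]setTI; exact: measurable_shift_tuple.
have EE : 1 <= gauss E + gauss E'.
  apply: (@le_trans _ _ (gauss (E `|` E'))); last exact: measureU2.
  rewrite (_ : E `|` E' = setT) ?probability_setT//.
  by apply/seteqP; split => // t _; case: (F12 t) => [/FE1 ?|/FE2 ?]; [left|right].
move: EE (probability_le1 gauss mX) (probability_le1 gauss mX') E1e E2e.
have fin (B : set T) : measurable B -> gauss B \is a fin_num.
  by move=> mB; exact: fin_num_measure.
rewrite -(fineK (fin _ mE)) -(fineK (fin _ mE')) -(fineK (fin _ mE1)).
rewrite -(fineK (fin _ mE2)) -(fineK (fin _ mX)) -(fineK (fin _ mX')).
rewrite -!EFinD -!EFinM !lee_fin.
set q := expR _; move: (fine _) (fine _) (fine _) (fine _) (fine _) (fine _).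
move=> g2 g1 gX' gX gE' gE EE X1 X1' E1e E2e I2 I1.
have q0 : (0 < q)%R by exact: expR_gt0.
have -> : expR (- (\sum_i c i ^+ 2)) = (q ^+ 2)%R.
  by rewrite /q -expRM_natl; congr expR; field.
have qa : (q <= a * e + a^-1)%R.
  have : (q * 1 <= q * (gE + gE'))%R by rewrite ler_wpM2l ?(ltW q0).
  have : (a / 2 * g1 <= a / 2 * e)%R by rewrite ler_wpM2l// divr_ge0// ltW.
  have : (a / 2 * g2 <= a / 2 * e)%R by rewrite ler_wpM2l// divr_ge0// ltW.
  have : (a^-1 / 2 * gX <= a^-1 / 2 * 1)%R.
    by rewrite ler_wpM2l// divr_ge0// invr_ge0 ltW.
  have : (a^-1 / 2 * gX' <= a^-1 / 2 * 1)%R.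
    by rewrite ler_wpM2l// divr_ge0// invr_ge0 ltW.
  move: I1 I2; lra.
have ae : (a * e + a^-1 = 2 * Num.sqrt e)%R.
  rewrite /a invrK -{2}(sqr_sqrtr (ltW e0)) expr2 mulKf//; first by ring.
  by rewrite gt_eqF// sqrtr_gt0.
rewrite ae in qa.
apply: (@le_trans _ _ ((2 * Num.sqrt e) ^+ 2)%R).
  by rewrite ler_pXn2r// nnegrE ?(ltW q0)// mulr_ge0// sqrtr_ge0.
rewrite exprMn sqr_sqrtr ?(ltW e0)// /e; lra.
Qed.

Let measurable_lin (c : 'I_m -> R) :
  measurable_fun setT (fun t : T => \sum_i c i * tnth t i : measurableTypeR R)%R.
Proof.
apply: measurable_sum => i; apply: measurable_funM => //.
exact: measurable_tnth.
Qed.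

Lemma measurable_halfspace (c : 'I_m -> R) (a : R) :
  measurable [set t : T | (a < \sum_i c i * tnth t i)%R].
Proof.
have := @measurable_lin c measurableT `]a, +oo[%classic (measurable_itv _).
rewrite setTI; congr measurable.
by apply/seteqP; split => t /=; rewrite in_itv/= andbT.
Qed.

(** Translating by -c turns the event into the half-space {<c, t> > 0}, on
    which the likelihood ratio is at most expR (- |c|^2 / 2). *)
Lemma std_gaussian_halfspace (c : 'I_m -> R) :
  gauss [set t | (\sum_i c i ^+ 2 < \sum_i c i * tnth t i)%R] <=
  (expR (- (\sum_i c i ^+ 2) / 2))%:E *
  gauss [set t | (0 < \sum_i c i * tnth t i)%R].
Proof.
set H := [set t | (0 < _)%R].
have mH : measurable H by exact: measurable_halfspace.
rewrite (_ : [set t | _] = shift_tuple (fun i => - c i)%R @^-1` H); last first.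
  apply: eq_set => t; rewrite /H/= -subr_gt0 -sumrB; congr (is_true (_ < _)%R).
  by apply: eq_bigr => i _; rewrite tnth_mktuple mulrBr expr2.
rewrite std_gaussian_shiftE// -[X in gauss X]setIT -integral_indic//.
have m1 : measurable_fun setT (fun t : T => (\1_H t)%:E : \bar R).
  exact/measurable_EFinP/measurable_indic.
rewrite -ge0_integralZl//.
apply: ge0_le_integral => //.
- by move=> t _; rewrite mule_ge0// lee_fin expR_ge0.
- apply: emeasurable_funM => //; apply/measurable_EFinP.
  exact: measurable_shift_density.
- exact: emeasurable_funM.
move=> t _; rewrite -!EFinM lee_fin indicE.
case: (boolP (t \in H)) => [|_]; last by rewrite mul0r mulr0.
rewrite inE => Ht; rewrite mul1r mulr1 ler_expR.
rewrite (_ : \sum_i (_ - _) = - (\sum_i c i * tnth t i)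
   - (\sum_i c i ^+ 2) / 2)%R.
  by move: Ht; rewrite /H/=; lra.
rewrite mulr_suml -sumrN -sumrB; apply: eq_bigr => i _.
by rewrite sqrrN mulNr.
Qed.

Lemma measurable_std_gaussian_tail (c : 'I_m -> R) (a : R) :
  measurable [set t : T | (a < `|\sum_i c i * tnth t i|)%R].
Proof.
rewrite (_ : [set t | _] = [set t | (a < \sum_i c i * tnth t i)%R] `|`
  [set t | (a < \sum_i (- c i) * tnth t i)%R]).
  by apply: measurableU; exact: measurable_halfspace.
have cN t : (\sum_i (- c i) * tnth t i = - \sum_i c i * tnth t i)%R.
  by rewrite -sumrN; apply: eq_bigr => i _; rewrite mulNr.
apply/seteqP; split => t /=; rewrite cN lter_normr.
  by move=> /orP[]; [left|right].
by move=> [] ->; rewrite ?orbT.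
Qed.

(** The constant 1 in front of the exponential is what lets n such events be
    excluded at total cost eps; it comes from the two opposite half-spaces
    having total mass at most 1. *)
Lemma std_gaussian_tail (c : 'I_m -> R) :
  gauss [set t | (\sum_i c i ^+ 2 < `|\sum_i c i * tnth t i|)%R] <=
  (expR (- (\sum_i c i ^+ 2) / 2))%:E.
Proof.
pose c' i := (- c i)%R.
have c'E t : (\sum_i c' i * tnth t i = - \sum_i c i * tnth t i)%R.
  by rewrite -sumrN; apply: eq_bigr => i _; rewrite mulNr.
have c'2 : (\sum_i c' i ^+ 2 = \sum_i c i ^+ 2)%R.
  by apply: eq_bigr => i _; rewrite sqrrN.
set s := (\sum_i c i ^+ 2)%R.
rewrite (_ : [set t | _] = [set t | (s < \sum_i c i * tnth t i)%R] `|`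
  [set t | (s < \sum_i c' i * tnth t i)%R]); last first.
  apply/seteqP; split => t /=; rewrite c'E lter_normr.
    by move=> /orP[]; [left|right].
  by move=> [] ->; rewrite ?orbT.
apply: le_trans (measureU2 _ _ _) _ => //; [exact: measurable_halfspace..|].
apply: (le_trans (leeD (std_gaussian_halfspace c) _)).
  by have := std_gaussian_halfspace c'; rewrite c'2; apply.
rewrite -/s -ge0_muleDr ?measure_ge0//.
rewrite -[leRHS]mule1 lee_wpmul2l ?lee_fin ?expR_ge0//.
rewrite -measureU; [|exact: measurable_halfspace..|].
  apply: probability_le1.
  by apply: measurableU; exact: measurable_halfspace.
apply/seteqP; split => // t [] /=; rewrite c'E oppr_gt0 => /lt_trans h /h.
by rewrite ltxx.
Qed.

End gauss_ineq.

(** * Inner products, separation and the largest singular value *)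

Section dotp.
Context {R : realType}.

(** The Euclidean norm as a square root of the inner product, instead of the
    real powers of lpnorm. *)
Definition enorm n (u : 'cV[R]_n) : R := Num.sqrt (dotp u u).

Section dotp_n.
Variable n : nat.
Implicit Types u v w : 'cV[R]_n.

Lemma dotpC u v : dotp u v = dotp v u.
Proof. by apply: eq_bigr => i _; rewrite mulrC. Qed.

Lemma dotpDl u v w : dotp (u + v) w = dotp u w + dotp v w.
Proof. by rewrite -big_split; apply: eq_bigr => i _; rewrite mxE mulrDl. Qed.

Lemma dotpZl a u w : dotp (a *: u) w = a * dotp u w.
Proof. by rewrite mulr_sumr; apply: eq_bigr => i _; rewrite mxE mulrA. Qed.

Lemma dotpDr u v w : dotp w (u + v) = dotp w u + dotp w v.
Proof. by rewrite dotpC dotpDl !(dotpC w). Qed.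

Lemma dotpZr a u w : dotp w (a *: u) = a * dotp w u.
Proof. by rewrite dotpC dotpZl (dotpC w). Qed.

Lemma dotpNl u w : dotp (- u) w = - dotp u w.
Proof. by rewrite -scaleN1r dotpZl mulN1r. Qed.

Lemma dotpNr u w : dotp w (- u) = - dotp w u.
Proof. by rewrite dotpC dotpNl dotpC. Qed.

Lemma dotpBl u v w : dotp (u - v) w = dotp u w - dotp v w.
Proof. by rewrite dotpDl dotpNl. Qed.

Lemma dotpBr u v w : dotp w (u - v) = dotp w u - dotp w v.
Proof. by rewrite dotpDr dotpNr. Qed.

Lemma dotp0l u : dotp 0 u = 0.
Proof. by rewrite -(scale0r 0) dotpZl mul0r. Qed.

Lemma dotp0r u : dotp u 0 = 0.
Proof. by rewrite dotpC dotp0l. Qed.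

Lemma dotp_basisl i u : dotp (basis_vec i) u = u i ord0.
Proof.
rewrite /dotp (bigD1 i)//= big1 => [|j ji]; first by rewrite addr0 mxE !eqxx mul1r.
by rewrite mxE (negbTE ji) mul0r.
Qed.

Lemma dotp_ge0 u : 0 <= dotp u u.
Proof. by apply: sumr_ge0 => i _; rewrite -expr2 sqr_ge0. Qed.

Lemma dotp_eq0 u : dotp u u = 0 -> u = 0.
Proof.
move=> /eqP; rewrite psumr_eq0 => [/allP h|i _]; last by rewrite -expr2 sqr_ge0.
apply/colP => i; rewrite mxE; apply/eqP.
by have := h i (mem_index_enum _); rewrite /= mulf_eq0 orbb.
Qed.

Lemma sqr_coord_le_dotp u i : u i ord0 ^+ 2 <= dotp u u.
Proof.
rewrite /dotp (bigD1 i)//= -expr2 lerDl.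
by apply: sumr_ge0 => j _; rewrite -expr2 sqr_ge0.
Qed.

Lemma lpnorm2E u : lpnorm 2%:E u = enorm u.
Proof.
rewrite /lpnorm powR12_sqrt//; last by apply: sumr_ge0 => i _; exact: powR_ge0.
congr Num.sqrt; apply: eq_bigr => i _.
by rewrite (powR_mulrn 2)// real_normK ?num_real// expr2.
Qed.

Lemma enorm_ge0 u : 0 <= enorm u.
Proof. by rewrite /enorm sqrtr_ge0. Qed.

Lemma sqr_enorm u : enorm u ^+ 2 = dotp u u.
Proof. by rewrite /enorm sqr_sqrtr// dotp_ge0. Qed.

Lemma enorm_eq0 u : enorm u = 0 -> u = 0.
Proof. by move=> u0; apply: dotp_eq0; rewrite -sqr_enorm u0 expr0n. Qed.

Lemma enormZ a u : enorm (a *: u) = `|a| * enorm u.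
Proof.
rewrite !/enorm dotpZl dotpZr mulrA -expr2 sqrtrM ?sqr_ge0//.
by rewrite sqrtr_sqr.
Qed.

Lemma cauchy_schwarz u v : dotp u v <= enorm u * enorm v.
Proof.
set p := enorm u; set q := enorm v.
have [/enorm_eq0 u0|p0] := eqVneq p 0.
  by rewrite u0 dotp0l mulr_ge0// enorm_ge0.
have [/enorm_eq0 v0|q0] := eqVneq q 0.
  by rewrite v0 dotp0r mulr_ge0// enorm_ge0.
have pq : 0 < p * q.
  by apply: mulr_gt0; [rewrite lt0r p0 enorm_ge0|rewrite lt0r q0 enorm_ge0].
have := dotp_ge0 (q *: u - p *: v).
rewrite dotpBl !dotpBr !dotpZl !dotpZr -!sqr_enorm (dotpC v u) -/p -/q.
move: p q (dotp u v) pq {p0 q0} => p q d pq.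
rewrite (_ : _ - _ = 2 * (p * q) * (p * q - d)); last by ring.
by rewrite pmulr_rge0 ?subr_ge0// mulr_gt0.
Qed.

Lemma enormD u v : enorm (u + v) <= enorm u + enorm v.
Proof.
rewrite -(@ler_pXn2r _ 2)// ?nnegrE ?addr_ge0 ?enorm_ge0//.
rewrite sqr_enorm sqrrD !sqr_enorm dotpDl !dotpDr (dotpC v u).
have := cauchy_schwarz u v; lra.
Qed.

Lemma dotp_segment u v t :
  dotp (u + t *: v) (u + t *: v) - dotp u u =
  2 * t * dotp u v + t ^+ 2 * dotp v v.
Proof. by rewrite dotpDl !dotpDr !dotpZl !dotpZr (dotpC v u); ring. Qed.

End dotp_n.

Lemma dotp_mulmx m n (A : 'M[R]_(m, n)) (u : 'cV[R]_m) (v : 'cV[R]_n) :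
  dotp u (A *m v) = dotp (A^T *m u) v.
Proof.
rewrite /dotp.
under eq_bigr do rewrite mxE mulr_sumr.
rewrite exchange_big; apply: eq_bigr => j _ /=.
rewrite mxE mulr_suml; apply: eq_bigr => i _.
by rewrite mxE mulrA [A i j * _]mulrC.
Qed.

(** First-order optimality along a segment issued from a minimizer. *)
Lemma quad_ge0_linear (b q : R) :
  (forall t, 0 < t -> t <= 1 -> 0 <= 2 * t * b + t ^+ 2 * q) -> 0 <= q -> 0 <= b.
Proof.
move=> h q0; rewrite leNgt; apply/negP => b0.
have qb : 0 < q - b by lra.
pose t := - b / (q - b).
have t0 : 0 < t by rewrite divr_gt0// oppr_gt0.
have t1 : t <= 1 by rewrite ler_pdivrMr// mul1r; lra.
have := h t t0 t1.
rewrite (_ : _ + _ = t * (2 * b + t * q)); last by ring.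
rewrite pmulr_rge0//.
have : t * q <= - b.
  by rewrite /t mulrAC ler_pdivrMr// ler_wpM2l ?oppr_ge0 ?ltW//; lra.
lra.
Qed.

Lemma convex_combP (n : nat) (K : set 'cV[R]_n) : convex_set K ->
  forall x y t, K x -> K y -> 0 <= t -> t <= 1 -> K (t *: x + (1 - t) *: y).
Proof.
move=> cK x y t Kx Ky t0 t1.
have := cK x y (Itv01 t0 t1); rewrite !inE; exact.
Qed.

Lemma convex_setP (n : nat) (K : set 'cV[R]_n) :
  (forall x y t, K x -> K y -> 0 <= t -> t <= 1 -> K (t *: x + (1 - t) *: y)) ->
  convex_set K.
Proof.
by move=> cK x y t; rewrite !inE => Kx Ky; apply: cK.
Qed.

Lemma continuous_sqnorm_mx m n (A : 'M[R]_(m, n)) :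
  continuous (fun v : 'rV[R]_n => dotp (A *m v^T) (A *m v^T)).
Proof.
have cs p (F : 'I_p -> 'rV[R]_n -> R) : (forall i, continuous (F i)) ->
    continuous (fun v => \sum_i F i v).
  move=> cF; elim: p F cF => [|p IHp] F cF v.
    rewrite (_ : (fun _ => _) = cst 0); first exact: cst_continuous.
    by apply/funext => w; rewrite big_ord0.
  rewrite (_ : (fun _ => _) =
      (fun w => F ord0 w + \sum_i F (lift ord0 i) w)); last first.
    by apply/funext => w; rewrite big_ord_recl.
  by apply: continuousD; [exact: cF|apply: IHp => i; exact: cF].
have clin i : continuous (fun w : 'rV[R]_n => (A *m w^T) i ord0).
  rewrite (_ : (fun _ => _) = (fun w : 'rV[R]_n => \sum_j A i j * w ord0 j)).
    apply: (cs _ _ _) => j v; apply: continuousM; first exact: cst_continuous.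
    exact: coord_continuous.
  by apply/funext => w; rewrite mxE; apply: eq_bigr => j _; rewrite mxE.
by apply: (cs _ _ _) => i v; apply: continuousM; exact: clin.
Qed.

Lemma continuous_sqnorm n : continuous (fun v : 'rV[R]_n => dotp v^T v^T).
Proof.
have := @continuous_sqnorm_mx n n 1%:M.
by under eq_fun do rewrite mul1mx.
Qed.

Lemma bounded_sqnorm n (D : set 'rV[R]_n) (M : R) :
  (forall v, D v -> dotp v^T v^T <= M) -> bounded_set D.
Proof.
move=> DM; exists (Num.sqrt M); split; first exact: num_real.
move=> r rM v Dv /=.
rewrite [leLHS]/Num.norm/= mx_normrE; apply: bigmax_le => [|[i j] _ /=].
  by rewrite (le_trans _ (ltW rM))// sqrtr_ge0.
rewrite (le_trans _ (ltW rM))// -sqrtr_sqr ler_wsqrtr//.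
apply: le_trans (DM v Dv).
by have := sqr_coord_le_dotp v^T j; rewrite mxE (ord1 i).
Qed.

Lemma continuous_affine_line n (c : 'rV[R]_n) (t : R) :
  continuous (fun v : 'rV[R]_n => c + t *: v).
Proof.
move=> v; apply: (@continuousD R 'rV[R]_n); first exact: cst_continuous.
exact: (@scaler_continuous R 'rV[R]_n).
Qed.

(** The point is the one of least norm in the closure of K, so K need not be
    closed: all that is lost is that it may lie outside K. *)
Lemma convex_min_norm n (K : set 'cV[R]_n) :
  K !=set0 -> convex_set K ->
  exists z, (forall k, K k -> dotp z z <= dotp z k) /\
    (forall d, (forall k, K k -> d <= dotp k k) -> d <= dotp z z).
Proof.
move=> [k0 Kk0] /convex_combP cK.
pose Q (v : 'rV[R]_n) := dotp v^T v^T.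
have cQ : continuous Q by exact: continuous_sqnorm.
pose C := closure [set v : 'rV[R]_n | K v^T].
pose D := C `&` [set v | Q v <= dotp k0 k0].
have CK k : K k -> C k^T.
  by move=> Kk; apply: subset_closure; rewrite /= trmxK.
have D0 : D !=set0 by exists k0^T; split; [exact: CK|rewrite /Q/= trmxK].
have cD : compact D.
  apply: bounded_closed_compact.
    by apply: (@bounded_sqnorm _ _ (dotp k0 k0)) => v [].
  apply: closedI; first exact: closed_closure.
  apply: (@preimage_closed _ _ Q [set x | x <= dotp k0 k0]).
    by move=> x _; exact: cQ.
  exact: closed_le.
have [z zD zmin] := @compact_EVT_min _ _ Q D D0 cD (continuous_subspaceT cQ).
have {}zD : D z by rewrite inE in zD.
have {}zmin v : C v -> Q z <= Q v.
  move=> Cv; have [vk|/ltW kv] := leP (Q v) (dotp k0 k0).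
    by apply: zmin; rewrite inE.
  by rewrite (le_trans _ kv)//; case: zD.
exists z^T; split => [k Kk|d dK]; last first.
  have Cd : C `<=` [set v | d <= Q v].
    apply: (@subset_trans _ (closure [set v | d <= Q v])).
      by apply: closure_subset => v /dK.
    have /closure_id <- // : closed [set v | d <= Q v].
    apply: (@preimage_closed _ _ Q [set x | d <= x]).
      by move=> x _; exact: cQ.
    exact: closed_ge.
  by apply: Cd; case: zD.
rewrite -subr_ge0 -dotpBr.
apply: (@quad_ge0_linear _ (dotp (k - z^T) (k - z^T))); last exact: dotp_ge0.
move=> t t0 t1.
pose f (v : 'rV[R]_n) : 'rV[R]_n := t *: k^T + (1 - t) *: v.
have cf : continuous f := @continuous_affine_line _ (t *: k^T) (1 - t).
have Cf : C (f z).
  move=> B /cf nB; have [v [Kv Bv]] := zD.1 _ nB.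
  exists (f v); split => //=.
  by rewrite /f linearD !linearZ/= trmxK; apply: cK => //; exact: ltW.
have := zmin _ Cf; rewrite -subr_ge0 /Q.
rewrite (_ : (f z)^T = z^T + t *: (k - z^T)) ?dotp_segment//.
by rewrite /f linearD !linearZ/= trmxK scalerBl scale1r scalerBr addrCA.
Qed.

Lemma singular_bounded m n (A : 'M[R]_(m, n)) (l : R) :
  (forall v : 'cV[R]_n, dotp (A *m v) (A *m v) <= l * dotp v v) ->
  forall t, 0 <= t -> eigenvalue (A^T *m A) (t ^+ 2) -> t ^+ 2 <= l.
Proof.
move=> Al t t0 /eigenvalueP[v vA v0].
have {}v0 : 0 < dotp v^T v^T.
  rewrite lt_def dotp_ge0 andbT; apply: contra v0 => /eqP/dotp_eq0 v0.
  by rewrite -[v]trmxK v0 trmx0.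
have : A^T *m (A *m v^T) = t ^+ 2 *: v^T.
  by rewrite mulmxA -linearZ/= -vA trmx_mul trmx_mul trmxK.
move=> /(congr1 (dotp v^T)); rewrite dotp_mulmx trmxK dotpZr => e.
by have := Al v^T; rewrite e ler_pM2r.
Qed.

(** A maximizer of |A v|^2 on the unit sphere satisfies the first-order
    condition A^T A v = l v, so the operator norm is itself a singular value;
    by comparison with it, the set of singular values is bounded. *)
Lemma max_singular_valueP m n (A : 'M[R]_(m, n)) : (0 < n)%N ->
  0 <= max_singular_value A /\
  forall v, dotp (A *m v) (A *m v) <= max_singular_value A ^+ 2 * dotp v v.
Proof.
move=> n0.
pose Q (v : 'rV[R]_n) := dotp v^T v^T.
pose f (v : 'rV[R]_n) := dotp (A *m v^T) (A *m v^T).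
have cQ : continuous Q by exact: continuous_sqnorm.
have cf : continuous f by exact: continuous_sqnorm_mx.
pose D := [set v | Q v = 1].
have D0 : D !=set0.
  exists (basis_vec (Ordinal n0))^T.
  by rewrite /D/= /Q trmxK dotp_basisl mxE !eqxx.
have cD : compact D.
  apply: bounded_closed_compact.
    by apply: (@bounded_sqnorm _ _ 1) => v Dv; rewrite -/(Q v) Dv.
  apply: (@preimage_closed _ _ Q [set x | x = 1]).
    by move=> x _; exact: cQ.
  exact: closed_eq.
have [v0 v0D v0max] := @compact_EVT_max _ _ f D D0 cD (continuous_subspaceT cf).
have {}v0D : Q v0 = 1 by rewrite inE in v0D.
set l := f v0 in v0max.
have Al (v : 'cV[R]_n) : dotp (A *m v) (A *m v) <= l * dotp v v.
  have [vv0|vv0] := eqVneq (dotp v v) 0.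
    by rewrite (dotp_eq0 vv0) mulmx0 !dotp0l mulr0.
  have vp : 0 < dotp v v by rewrite lt_def vv0 dotp_ge0.
  pose w := (Num.sqrt (dotp v v))^-1 *: v.
  have sq : (Num.sqrt (dotp v v))^-1 * (Num.sqrt (dotp v v))^-1 = (dotp v v)^-1.
    by rewrite -invfM -expr2 sqr_sqrtr ?ltW.
  have : f w^T <= l.
    apply: v0max; rewrite inE /D/= /Q trmxK /w dotpZl dotpZr mulrA sq.
    by rewrite mulVf.
  rewrite /f trmxK /w -scalemxAr dotpZl dotpZr mulrA sq.
  by rewrite mulrC ler_pdivrMr.
have l0 : 0 <= l by exact: dotp_ge0.
have eig : eigenvalue (A^T *m A) (Num.sqrt l ^+ 2).
  rewrite sqr_sqrtr//; apply/eigenvalueP; exists v0; last first.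
    apply/eqP => v00; move: v0D; rewrite /Q v00 trmx0 dotp0l => /esym/eqP.
    by rewrite oner_eq0.
  (* g is nonnegative and vanishes at v0, hence so does its gradient 2 r there *)
  pose r := l *: v0^T - A^T *m (A *m v0^T).
  pose g (v : 'cV[R]_n) := l * dotp v v - dotp (A *m v) (A *m v).
  have gE y t : g (v0^T + t *: y) =
      2 * t * (l * dotp v0^T y - dotp (A *m v0^T) (A *m y)) + t ^+ 2 * g y.
    rewrite /g mulmxDr -scalemxAr.
    have /eqP := dotp_segment v0^T y t; rewrite subr_eq => /eqP ->.
    have /eqP := dotp_segment (A *m v0^T) (A *m y) t; rewrite subr_eq => /eqP ->.
    have -> : dotp v0^T v0^T = 1 by [].
    by rewrite -/(f v0) -/l; ring.
  have rE y : dotp r y = l * dotp v0^T y - dotp (A *m v0^T) (A *m y).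
    by rewrite [in RHS]dotp_mulmx -dotpZl -dotpBl.
  have : 0 <= dotp r (- r).
    apply: (@quad_ge0_linear _ (g (- r))); last by rewrite subr_ge0.
    move=> t t0 t1.
    by rewrite rE -gE subr_ge0.
  rewrite dotpNr oppr_ge0 => r0.
  have {}r0 : r = 0 by apply: dotp_eq0; apply/eqP; rewrite eq_le r0 dotp_ge0.
  apply: trmx_inj; rewrite linearZ/= !trmx_mul trmxK -mulmxA.
  by move/eqP: r0; rewrite subr_eq0 => /eqP.
have ub : has_ubound
    [set t : R | 0 <= t /\ eigenvalue (A^T *m A) (t ^+ 2)].
  exists (Num.sqrt l) => t [t0 et].
  by rewrite -[t]ger0_norm// -sqrtr_sqr ler_wsqrtr// (singular_bounded Al).
have le_l : Num.sqrt l <= max_singular_value A.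
  by apply: ub_le_sup => //; split => //; exact: sqrtr_ge0.
have s0 := le_trans (sqrtr_ge0 l) le_l.
split=> // v; apply: (le_trans (Al v)); rewrite ler_wpM2r ?dotp_ge0//.
by rewrite -[l]sqr_sqrtr// ler_pXn2r// nnegrE sqrtr_ge0.
Qed.

(** By Cauchy-Schwarz, |A^T h|^2 = <h, A (A^T h)> <= |h| |A (A^T h)|. *)
Lemma max_singular_value_tr m n (A : 'M[R]_(m, n)) (h : 'cV[R]_m) : (0 < n)%N ->
  dotp (A^T *m h) (A^T *m h) <= max_singular_value A ^+ 2 * dotp h h.
Proof.
move=> n0; have [s0 As] := max_singular_valueP A n0.
set w := A^T *m h; set s := max_singular_value A in s0 As *.
have [->|w0] := eqVneq (dotp w w) 0.
  by rewrite mulr_ge0 ?sqr_ge0 ?dotp_ge0.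
have wp : 0 < dotp w w by rewrite lt_def w0 dotp_ge0.
have e : dotp w w = dotp h (A *m w) by rewrite [RHS]dotp_mulmx.
have e2 : dotp w w ^+ 2 <= dotp h h * dotp (A *m w) (A *m w).
  rewrite -!sqr_enorm -exprMn ler_pXn2r ?nnegrE ?mulr_ge0 ?enorm_ge0//.
    by rewrite sqr_enorm e cauchy_schwarz.
have := le_trans e2 (ler_wpM2l (dotp_ge0 h) (As w)).
by rewrite mulrCA mulrA expr2 ler_pM2r// mulrC.
Qed.

End dotp.

(** * Contrasts adapted to a support *)

Section shift_col.
Context {R : realType}.
Variables (m : nat) (mu : 'cV[R]_m) (sigma : R).
Hypothesis sigma0 : sigma != 0.
Implicit Types t : m.-tuple (measurableTypeR R).

(** Under the noise translated by the normalized mean, the observation is pure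
    noise: the means mu and - mu are both seen from their midpoint 0. *)
Lemma shift_col_sub t :
  mu + sigma *: tuple_col (shift_tuple (fun j => - (mu j ord0 / sigma)) t) =
  sigma *: tuple_col t.
Proof. by apply/colP => j; rewrite !mxE tnth_mktuple; field. Qed.

Lemma shift_col_add t :
  - mu + sigma *: tuple_col (shift_tuple (fun j => mu j ord0 / sigma) t) =
  sigma *: tuple_col t.
Proof. by apply/colP => j; rewrite !mxE tnth_mktuple; field. Qed.

End shift_col.

Section separation.
Context {R : realType}.
Variables (m n : nat) (A : 'M[R]_(m, n)) (U : set 'cV[R]_m).
Variables (sigma eps omega : R) (S : nat).
Hypotheses (eps0 : 0 < eps) (eps16 : eps < 1 / 16) (sigma0 : 0 < sigma).
Hypotheses (omega0 : 0 < omega) (hU : uncertainty_set U).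
Hypothesis (hO : condO A U sigma eps S omega).

Let L := ln (1 / eps).

Lemma ln_inv_eps_gt0 : 0 < L.
Proof. by rewrite ln_gt0// ltr_pdivlMr// mul1r; move: eps16; lra. Qed.

(** Reversing the signs of x and u exchanges the means A x + u and -(A x + u),
    while the values x_i and - x_i are at least 2 omega apart, so an
    omega-accurate routine tests one mean against the other. *)
Lemma condO_separated (i : 'I_n) (I : {set 'I_n}) (x : 'cV[R]_n) (u : 'cV[R]_m) :
  #|I| = S -> i \in I -> supported I x -> U u -> omega <= x i ord0 ->
  sigma * Num.sqrt (L / 2) <= enorm (A *m x + u).
Proof.
move=> cI iI sx Uu xi; case: hU => _ _ _ symU.
have [rout _ hrout] := hO cI iI.
set mu := A *m x + u.
have sNx : supported I (- x) by move=> j /sx xj; rewrite mxE xj oppr0.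
have h1 := hrout x u sx Uu.
have h2 := hrout (- x) (- u) sNx (symU u Uu).
pose c (j : 'I_m) := mu j ord0 / sigma.
have cover t : tuple_col (shift_tuple (fun j => - c j) t) \in
      [set e | omega <= `|rout (A *m x + u + sigma *: e) - x i ord0|] \/
    tuple_col (shift_tuple c t) \in
      [set e | omega <= `|rout (A *m (- x) - u + sigma *: e) - (- x) i ord0|].
  rewrite !inE/= mulmxN -opprD -/mu.
  rewrite shift_col_sub ?gt_eqF// shift_col_add ?gt_eqF//.
  move: (rout _) => r; rewrite mxE opprK.
  have [|rx] := leP omega `|r - x i ord0|; first by left.
  right; rewrite leNgt; apply/negP => rx'.
  move: rx rx'; rewrite !ltr_norml => /andP[? ?] /andP[? ?]; clear cI; lra.
have e4 : expR (- \sum_j c j ^+ 2) <= 4 * eps.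
  by apply: (test_separation eps0 h1 h2) => t; have := cover t; rewrite !inE.
have sc : \sum_j c j ^+ 2 = dotp mu mu / sigma ^+ 2.
  rewrite /dotp mulr_suml; apply: eq_bigr => j _.
  by rewrite /c; field; rewrite gt_eqF.
have {e4} : L / 2 <= dotp mu mu / sigma ^+ 2.
  rewrite -sc; move: e4; rewrite -[X in _ <= X]lnK ?posrE ?mulr_gt0// ler_expR.
  rewrite lnM ?posrE//.
  (* eps < 1 / 16 gives ln (1 / (4 eps)) >= ln (1 / eps) / 2 *)
  have e16 : ln eps <= - (2 * ln 4).
    rewrite (_ : 2 * ln 4 = ln 16); last first.
      by rewrite (_ : 16 = 4 ^+ 2)//; [rewrite lnXn// mulr_natl|lra].
    rewrite -lnV ?posrE//; rewrite ler_ln ?posrE ?invr_gt0//.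
    by apply: ltW; rewrite -div1r.
  rewrite /L div1r lnV ?posrE//; lra.
rewrite ler_pdivlMr ?exprn_gt0// => h.
have L0 : 0 <= L / 2 by rewrite divr_ge0// ltW// ln_inv_eps_gt0.
rewrite -(@ler_pXn2r _ 2)// ?nnegrE ?enorm_ge0//; last first.
  by rewrite mulr_ge0 ?sqrtr_ge0// ltW.
by rewrite sqr_enorm exprMn sqr_sqrtr// mulrC.
Qed.

Local Notation c0 := (sigma * Num.sqrt (L / 2)).

Lemma c0_gt0 : 0 < c0.
Proof. by rewrite mulr_gt0// sqrtr_gt0 divr_gt0// ln_inv_eps_gt0. Qed.

(** Separating hyperplane between the ball of radius c0 and the convex set of
    the means A x + u with x supported on I and x_i = omega: its normal must be
    orthogonal to the directions A e_j in which that set is unbounded. *)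
Lemma contrast_on_support (i : 'I_n) (I : {set 'I_n}) :
  #|I| = S -> i \in I ->
  exists h : 'cV[R]_m, [/\ (A^T *m h) i ord0 = 1,
    forall j, j \in I -> j != i -> (A^T *m h) j ord0 = 0
    & forall u, U u -> dotp u h + c0 * enorm h <= omega].
Proof.
move=> cI iI; case: (hU) => -[u0 Uu0] cU _ symU.
pose K := [set w | exists x u, [/\ supported I x, x i ord0 = omega, U u
  & w = A *m x + u]].
have sb j a : j \in I -> supported I (a *: basis_vec j : 'cV[R]_n).
  move=> jI l lI; rewrite !mxE; have [lj|] := eqVneq l j; last by rewrite mulr0.
  by move: lI; rewrite lj jI.
have sD (x y : 'cV[R]_n) : supported I x -> supported I y -> supported I (x + y).
  by move=> sx sy l lI; rewrite mxE sx// sy// addr0.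
have sZ a (x : 'cV[R]_n) : supported I x -> supported I (a *: x).
  by move=> sx l lI; rewrite mxE sx// mulr0.
have bi : (basis_vec i : 'cV[R]_n) i ord0 = 1 by rewrite mxE !eqxx.
have K0 : K !=set0.
  exists (A *m (omega *: basis_vec i) + u0), (omega *: basis_vec i), u0.
  by split=> //; [exact: sb|rewrite mxE bi mulr1].
have cK : convex_set K.
  apply: convex_setP => _ _ t [x [u [sx xi Uu ->]]] [y [v [sy yi Uv ->]]] t0 t1.
  exists (t *: x + (1 - t) *: y), (t *: u + (1 - t) *: v); split.
  - by apply: sD; exact: sZ.
  - by rewrite !mxE xi yi; ring.
  - exact: convex_combP.
  - by rewrite mulmxDr -!scalemxAr !scalerDr addrACA.
have [z [zmin zinf]] := convex_min_norm K0 cK.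
have zc : c0 <= enorm z.
  rewrite -(@ler_pXn2r _ 2)// ?nnegrE ?enorm_ge0 ?(ltW c0_gt0)//.
  rewrite sqr_enorm; apply: zinf => _ [x [u [sx xi Uu ->]]].
  rewrite -sqr_enorm ler_pXn2r// ?nnegrE ?enorm_ge0 ?(ltW c0_gt0)//.
  by apply: (condO_separated cI iI sx Uu); rewrite xi.
have z0 : 0 < enorm z by exact: lt_le_trans c0_gt0 zc.
set b := A^T *m z.
have dotb j : dotp z (A *m basis_vec j) = b j ord0.
  by rewrite dotp_mulmx dotpC dotp_basisl.
have key j a u : j \in I -> j != i -> U u ->
    dotp z z <= omega * b i ord0 + a * b j ord0 + dotp z u.
  move=> jI ji Uu.
  have := zmin (A *m (omega *: basis_vec i + a *: basis_vec j) + u).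
  rewrite dotpDr mulmxDr -!scalemxAr dotpDr !dotpZr !dotb; apply.
  exists (omega *: basis_vec i + a *: basis_vec j), u; split => //.
  - by apply: sD; exact: sb.
  - by rewrite !mxE !eqxx eq_sym (negbTE ji) mulr0 addr0 mulr1.
  - by rewrite mulmxDr -!scalemxAr.
have key0 u : U u -> dotp z z <= omega * b i ord0 + dotp z u.
  move=> Uu; have := zmin (A *m (omega *: basis_vec i) + u).
  rewrite dotpDr -!scalemxAr !dotpZr !dotb; apply.
  exists (omega *: basis_vec i), u; split => //; first exact: sb.
  - by rewrite mxE bi mulr1.
  - by rewrite -scalemxAr.
have zz : 0 < dotp z z by rewrite -sqr_enorm exprn_gt0.
have bi0 : 0 < b i ord0.
  have := key0 _ Uu0; have := key0 _ (symU _ Uu0); rewrite dotpNr => h1 h2.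
  by rewrite -(pmulr_rgt0 _ omega0); lra.
exists ((b i ord0)^-1 *: z); rewrite -scalemxAr -/b; split.
- by rewrite mxE mulVf// gt_eqF.
- move=> j jI ji; rewrite mxE; apply/eqP; rewrite mulf_eq0; apply/orP; right.
  apply/eqP/eqP; apply: contraT => bj0.
  set e := omega * b i ord0 + dotp z u0.
  (* moving this far along A e_j would violate the separation by 1 *)
  have := key j ((dotp z z - e - 1) / b j ord0) u0 jI ji Uu0.
  by rewrite divfK// /e; lra.
- move=> u Uu; rewrite enormZ dotpZr ger0_norm ?invr_ge0 ?(ltW bi0)//.
  rewrite mulrCA -mulrDr mulrC ler_pdivrMr//.
  have := key0 _ (symU _ Uu); rewrite dotpNr (dotpC u) => h.
  have : c0 * enorm z <= dotp z z.
    by rewrite -sqr_enorm expr2 ler_wpM2r// ltW.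
  lra.
Qed.

End separation.

(** * One contrast per coordinate *)

(** Cutting off the k largest entries (and one more) leaves a tail of squared
    Euclidean norm at most t (N - k t) <= N^2 / (4 k), where N is the l1 norm
    and t bounds the entries of the tail. *)
Lemma l2_tail_le (R : realType) (n k : nat) (z : 'cV[R]_n) (i : 'I_n) :
  (k < n)%N ->
  exists I : {set 'I_n}, [/\ #|I| = k.+1, i \in I &
    4 * k%:R * \sum_(j | j \notin I) z j ord0 ^+ 2 <=
    (\sum_j `|z j ord0|) ^+ 2].
Proof.
move=> kn.
pose r (a b : 'I_n) := `|z b ord0| <= `|z a ord0|.
pose s := sort r (enum (predC1 i)).
have rtot : total r by move=> a b; exact: le_total.
have rtr : transitive r by move=> a b c ab bc; exact: le_trans bc ab.
have us : uniq s by rewrite sort_uniq enum_uniq.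
have ms j : (j \in s) = (j != i) by rewrite mem_sort mem_enum.
have ss : size s = n.-1.
  by rewrite size_sort -cardE cardC1 card_ord.
pose J : {set 'I_n} := [set x in take k s].
have cJ : #|J| = k.
  rewrite cardsE (card_uniqP _) ?take_uniq// size_takel// ss.
  by rewrite -ltnS prednK// (leq_ltn_trans _ kn).
have iJ : i \notin J.
  by rewrite inE; apply/negP => /mem_take; rewrite ms eqxx.
have rJ j l : j \notin i |: J -> l \in J -> `|z j ord0| <= `|z l ord0|.
  rewrite !inE negb_or => /andP[ji jJ] lJ.
  have jd : j \in drop k s.
    by have := ms j; rewrite -{1}(cat_take_drop k s) mem_cat (negbTE jJ) ji.
  have : pairwise r s.
    by rewrite -sorted_pairwise//; exact: sort_sorted.
  rewrite -{1}(cat_take_drop k s) pairwise_cat => /and3P[/allrelP h _ _].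
  exact: h.
exists (i |: J); split; first by rewrite cardsU1 iJ cJ.
  by rewrite !inE eqxx.
set P := \sum_(l in J) `|z l ord0|.
set T := \sum_(j | j \notin i |: J) `|z j ord0|.
have P0 : 0 <= P by exact: sumr_ge0.
have T0 : 0 <= T by exact: sumr_ge0.
have kz j : j \notin i |: J -> k%:R * `|z j ord0| <= P.
  move=> jI; rewrite -cJ mulr_natl -sumr_const.
  by apply: ler_sum => l lJ; exact: rJ.
have PT : P + T <= \sum_j `|z j ord0|.
  rewrite [leRHS](bigID (mem (i |: J)))/= big_setU1//= -/P -/T.
  by rewrite lerD2r lerDr.
apply: (@le_trans _ _ (4 * (P * T))).
  rewrite -mulrA ler_pM2l// mulr_sumr mulr_sumr; apply: ler_sum => j jI.
  by rewrite -real_normK ?num_real// expr2 mulrA ler_wpM2r// kz.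
apply: (@le_trans _ _ ((P + T) ^+ 2)).
  rewrite -subr_ge0 (_ : _ - _ = (P - T) ^+ 2) ?sqr_ge0//; ring.
by rewrite ler_pXn2r// nnegrE ?addr_ge0// sumr_ge0.
Qed.

Lemma sub_basisE (R : realType) (n : nat) (w : 'cV[R]_n) (i j : 'I_n) :
  (w - basis_vec i) j ord0 = w j ord0 - (j == i)%:R.
Proof. by rewrite !mxE eqxx andbT. Qed.

Section contrast.
Context {R : realType}.
Variables (m n : nat) (A : 'M[R]_(m, n)) (U : set 'cV[R]_m).
Variables (sigma eps omega : R) (S s : nat).
Hypotheses (eps0 : 0 < eps) (eps16 : eps < 1 / 16) (sigma0 : 0 < sigma).
Hypotheses (omega0 : 0 < omega) (hU : uncertainty_set U).
Hypotheses (n0 : (0 < n)%N) (S0 : (0 < S)%N) (Sn : (S <= n)%N) (s0 : (0 < s)%N).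
Hypothesis (hO : condO A U sigma eps S omega).
Hypothesis hs : s%:R * (4 * omega * max_singular_value A)
    <= sigma * Num.sqrt (2 * S%:R * ln (1 / eps)).

Let L := ln (1 / eps).
Local Notation c0 := (sigma * Num.sqrt (L / 2)).
Let s1 : 1 <= s%:R :> R. Proof. by rewrite ler1n. Qed.
Let L0 : 0 < L. Proof. exact: ln_inv_eps_gt0. Qed.
Let c00 : 0 < c0. Proof. exact: c0_gt0. Qed.

(** What the duality argument of contrast_on_support yields besides the values
    of A^T h. The noise enters with the constant c0 of the two-point test; the
    one in nu is 2 sqrt (1 + ln n / ln (1 / eps)) times larger. *)
Definition admissible (h : 'cV[R]_m) : Prop :=
  forall u, U u -> dotp u h + c0 * enorm h <= omega.

Lemma admissible_convex : convex_set admissible.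
Proof.
apply: convex_setP => x y t hx hy t0 t1 u Uu.
have t1' : 0 <= 1 - t by rewrite subr_ge0.
have := enormD (t *: x) ((1 - t) *: y).
rewrite !enormZ !ger0_norm// => /(ler_wpM2l (ltW c00)) hn.
have := ler_wpM2l t0 (hx u Uu); have := ler_wpM2l t1' (hy u Uu).
rewrite dotpDr !dotpZr; lra.
Qed.

Lemma admissible_norm h : admissible h -> c0 * enorm h <= omega.
Proof.
move=> ah; case: hU => -[u Uu] _ _ symU.
have := ah u Uu; have := ah _ (symU u Uu); rewrite dotpNl; lra.
Qed.

Lemma admissible_nu h : admissible h ->
  nu n U sigma eps h <= 2 * Num.sqrt (1 + ln n%:R / L) * omega.
Proof.
move=> ah; rewrite /nu lpnorm2E.
set rho := Num.sqrt (1 + _).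
have n1 : (1 : R) <= n%:R by rewrite ler1n.
have lnL0 : 0 <= ln n%:R / L := divr_ge0 (ln_ge0 n1) (ltW L0).
have rho1 : 1 <= rho.
  by rewrite -[leLHS]sqrtr1 ler_wsqrtr// lerDl.
have e : sigma * Num.sqrt (2 * ln (n%:R / eps)) = 2 * rho * c0.
  have lnn : ln (n%:R / eps) = ln n%:R + L.
    by rewrite -lnM ?posrE ?div1r ?invr_gt0// ltr0n.
  have r0 : 0 <= 1 + ln n%:R / L by rewrite addr_ge0.
  rewrite [RHS]mulrCA -mulrA -sqrtrM//; congr (_ * _).
  rewrite (_ : 2 * Num.sqrt _ = Num.sqrt (2 ^+ 2 * ((1 + ln n%:R / L) * (L / 2)))).
    by congr Num.sqrt; rewrite lnn; field; rewrite gt_eqF.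
  by rewrite [RHS]sqrtrM ?sqr_ge0// sqrtr_sqr ger0_norm.
rewrite e.
have an := admissible_norm ah.
have : sup [set dotp u h | u in U] <= omega - c0 * enorm h.
  apply: ge_sup; first by case: hU => -[u Uu] _ _ _; exists (dotp u h), u.
  by move=> _ [u Uu <-]; have := ah u Uu; lra.
set a := c0 * enorm h in an *.
move: (sup _) => t ht; rewrite -[2 * rho * c0 * _]mulrA -/a.
have : 0 <= (omega - a) * (2 * rho - 1) by apply: mulr_ge0; lra.
move: a ht {an} rho rho1 {e} => a ht rho rho1 hh.
rewrite -subr_ge0 (_ : _ - _ = (omega - a) * (2 * rho - 1) + (omega - a - t)).
  by apply: addr_ge0; lra.
ring.
Qed.

Let c0E : c0 ^+ 2 = sigma ^+ 2 * (L / 2).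
Proof. by rewrite exprMn sqr_sqrtr// divr_ge0// ltW. Qed.

(** An admissible h has |h| <= omega / c0, and the range of s is what makes
    |A| |h| at most sqrt S / (2 s). *)
Lemma contrast_image_bound h : admissible h ->
  4 * s%:R ^+ 2 * dotp (A^T *m h) (A^T *m h) <= S%:R.
Proof.
move=> /admissible_norm ah.
have [sm0 _] := max_singular_valueP A n0.
have hs2 := hs; set sm := max_singular_value A in hs2 sm0 *.
have h1 := max_singular_value_tr A h n0; rewrite -/sm in h1.
have h2 : c0 ^+ 2 * dotp h h <= omega ^+ 2.
  rewrite -sqr_enorm -exprMn ler_pXn2r ?nnegrE ?mulr_ge0 ?enorm_ge0 ?(ltW omega0)//.
  exact: ltW.
have h3 : s%:R ^+ 2 * (4 ^+ 2 * omega ^+ 2 * sm ^+ 2) <= 4 * S%:R * c0 ^+ 2.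
  rewrite c0E; move: hs2; rewrite -(@ler_pXn2r _ 2)// ?nnegrE; last 2 first.
  - by rewrite !mulr_ge0// ltW.
  - by rewrite mulr_ge0 ?sqrtr_ge0// ltW.
  rewrite !exprMn sqr_sqrtr ?mulr_ge0 ?(ltW L0)// => /le_trans; apply.
  by rewrite le_eqVlt; apply/predU1P; left; rewrite /L; field.
set w := dotp (A^T *m h) _ in h1 *; set hh := dotp h h in h1 h2.
have c2 : 0 < 4 * c0 ^+ 2 by rewrite mulr_gt0 ?exprn_gt0.
rewrite -(ler_pM2l c2).
apply: le_trans (_ : 16 * s%:R ^+ 2 * (sm ^+ 2 * (c0 ^+ 2 * hh)) <= _).
  rewrite (_ : 4 * c0 ^+ 2 * _ = 16 * s%:R ^+ 2 * c0 ^+ 2 * w); last by ring.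
  rewrite (_ : 16 * s%:R ^+ 2 * (_ * _) = 16 * s%:R ^+ 2 * c0 ^+ 2 * (sm ^+ 2 * hh)).
    rewrite ler_wpM2l//; apply: mulr_ge0; rewrite ?sqr_ge0//.
  by ring.
apply: (@le_trans _ _ (16 * s%:R ^+ 2 * (sm ^+ 2 * omega ^+ 2))).
  by rewrite ler_wpM2l ?mulr_ge0 ?sqr_ge0// ler_wpM2l ?sqr_ge0.
rewrite (_ : 16 * _ * _ = s%:R ^+ 2 * (4 ^+ 2 * omega ^+ 2 * sm ^+ 2)); last by ring.
by rewrite (_ : 4 * c0 ^+ 2 * _ = 4 * S%:R * c0 ^+ 2)//; ring.
Qed.

(** The l2 bound on the tail of A^T h, once its unit i-th entry is removed,
    halved by the decay of the tail of a vector of unit l1 norm. *)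
Definition gamma0 : R :=
  Num.sqrt ((S%:R / (4 * s%:R ^+ 2) - 1) / (4 * (S%:R - 1))).

(** I consists of i and of the S - 1 other indices at which z is largest: the
    error A^T h - e_i of a contrast adapted to I vanishes on I, so only the
    tails of z and of A^T h meet in the inner product. *)
Lemma contrast_direction (i : 'I_n) (z : 'cV[R]_n) :
  exists2 h, admissible h &
    4 * s%:R ^+ 2 <= (S%:R : R) /\
    dotp z (A^T *m h - basis_vec i) <= gamma0 * \sum_j `|z j ord0|.
Proof.
have kn : (S.-1 < n)%N by rewrite prednK.
have [I [cI iI tail]] := l2_tail_le z i kn.
rewrite prednK// in cI.
have [h [wi wI ah]] := contrast_on_support eps0 eps16 sigma0 omega0 hU hO cI iI.
exists h => //.
set w := A^T *m h in wi wI *.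
have wS : 4 * s%:R ^+ 2 * dotp w w <= S%:R by exact: contrast_image_bound.
have w1 : 1 <= dotp w w.
  by have := sqr_coord_le_dotp w i; rewrite wi expr1n.
have s2 : 0 < 4 * s%:R ^+ 2 :> R.
  by rewrite mulr_gt0// exprn_gt0// ltr0n.
have S4 : 4 * s%:R ^+ 2 <= (S%:R : R).
  by apply: le_trans wS; rewrite ler_peMr// ltW.
split=> //.
have s21 : 1 <= s%:R ^+ 2 :> R by rewrite exprn_ege1.
have k0 : 0 < S%:R - 1 :> R by lra.
have kE : S.-1%:R = S%:R - 1 :> R by rewrite -subn1 natrB.
rewrite kE in tail.
pose z' : 'cV[R]_n := \col_j (if j \in I then 0 else z j ord0).
have -> : dotp z (w - basis_vec i) = dotp z' (w - basis_vec i).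
  apply: eq_bigr => j _; rewrite [z' _ _]mxE; case: ifP => // jI.
  rewrite !sub_basisE.
  have [->|ji] := eqVneq j i; first by rewrite wi subrr !mulr0.
  by rewrite wI// subrr !mulr0.
have z'E : dotp z' z' = \sum_(j | j \notin I) z j ord0 ^+ 2.
  rewrite [RHS]big_mkcond/=; apply: eq_bigr => j _; rewrite !mxE.
  by case: ifP => //= _; rewrite ?mul0r ?expr2.
have wE : dotp (w - basis_vec i) (w - basis_vec i) = dotp w w - 1.
  rewrite dotpBl !dotpBr (dotpC w (basis_vec i)) !dotp_basisl wi mxE !eqxx.
  by rewrite subrr subr0.
apply: (le_trans (cauchy_schwarz _ _)).
set N := \sum_j _ in tail *.
have N0 : 0 <= N by exact: sumr_ge0.
rewrite -(@ler_pXn2r _ 2)// ?nnegrE ?mulr_ge0 ?enorm_ge0 ?sqrtr_ge0//.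
rewrite !exprMn !sqr_enorm z'E wE sqr_sqrtr; last first.
  rewrite divr_ge0 ?mulr_ge0 ?(ltW k0)// subr_ge0 ler_pdivlMr// mul1r.
  exact: S4.
rewrite -/N in tail.
set T := \sum_(j | _) _ in tail *.
rewrite mulrAC ler_pdivlMr ?mulr_gt0//.
rewrite (_ : _ * _ * _ = (dotp w w - 1) * (4 * (S%:R - 1) * T)); last by ring.
apply: ler_pM => //.
- by rewrite subr_ge0.
- by rewrite !mulr_ge0 ?(ltW k0)//; apply: sumr_ge0 => j _; rewrite sqr_ge0.
- by rewrite lerD2r ler_pdivlMr// mulrC.
Qed.

(** Without the removal of the unit entry of A^T h the bound would be
    sqrt (S / (S - 1)) / (4 s), slightly too large. That the inequality is
    strict makes up for the convex sets below not being closed. *)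
Lemma gamma0_lt : 4 * s%:R ^+ 2 <= (S%:R : R) -> gamma0 < 1 / (4 * s%:R).
Proof.
move=> S4.
have s21 : 1 <= s%:R ^+ 2 :> R by rewrite exprn_ege1.
have sp : 0 < s%:R :> R by rewrite ltr0n.
have k0 : 0 < S%:R - 1 :> R by lra.
rewrite -(@ltr_pXn2r _ 2)// ?nnegrE; last 2 first.
- exact: sqrtr_ge0.
- by rewrite divr_ge0// mulr_ge0// ltW.
rewrite /gamma0 sqr_sqrtr; last first.
  rewrite divr_ge0 ?mulr_ge0 ?(ltW k0)// subr_ge0 ler_pdivlMr ?mul1r//.
  by rewrite mulr_gt0// exprn_gt0.
rewrite ltr_pdivrMr ?mulr_gt0//.
rewrite (_ : (1 / _) ^+ 2 * _ = (S%:R - 1) / (4 * s%:R ^+ 2)); last first.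
  by field; rewrite gt_eqF.
rewrite -subr_gt0 (_ : _ - _ = 1 - (4 * s%:R ^+ 2)^-1); last first.
  by field; rewrite gt_eqF.
rewrite subr_gt0.
by rewrite invf_lt1 ?mulr_gt0 ?exprn_gt0//; lra.
Qed.

(** If no admissible contrast came that close, the convex set of the errors A^T h - e_i
    would stay away from the box of radius gamma0, and a hyperplane separating
    the two would contradict contrast_direction. *)
Lemma contrast_exists (i : 'I_n) :
  exists2 h, admissible h &
    forall j, `|(A^T *m h - basis_vec i) j ord0| <= 1 / (4 * s%:R).
Proof.
have [h0 ah0 [S4 _]] := contrast_direction i 0.
have g0 := gamma0_lt S4.
have gg : 0 <= gamma0 by exact: sqrtr_ge0.
apply: contrapT => hn.
pose K := [set k : 'cV[R]_n | exists h (b : 'cV[R]_n), [/\ admissible h,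
  forall j, `|b j ord0| <= gamma0 & k = A^T *m h - basis_vec i + b]].
have K0 : K !=set0.
  exists (A^T *m h0 - basis_vec i + 0), h0, 0; split => // j.
  by rewrite mxE normr0.
have cK : convex_set K.
  apply: convex_setP => _ _ t [h [b [ah hb ->]]] [g [c [ag hc ->]]] t0 t1.
  have t1' : 0 <= 1 - t by rewrite subr_ge0.
  exists (t *: h + (1 - t) *: g), (t *: b + (1 - t) *: c); split.
  - exact: (convex_combP admissible_convex).
  - move=> j; rewrite !mxE (le_trans (ler_normD _ _))// !normrM (ger0_norm t0) (ger0_norm t1').
    have := ler_wpM2l t0 (hb j); have := ler_wpM2l t1' (hc j); lra.
  - rewrite mulmxDr -!scalemxAr; apply/colP => j; rewrite !mxE; ring.
have [z [zmin zinf]] := convex_min_norm K0 cK.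
set eta := 1 / (4 * s%:R) - gamma0.
have eta0 : 0 < eta by rewrite subr_gt0.
have zz : eta ^+ 2 <= dotp z z.
  apply: zinf => _ [h [b [ah hb ->]]].
  have [j hj] : exists j, 1 / (4 * s%:R) < `|(A^T *m h - basis_vec i) j ord0|.
    apply: contrapT => hj; apply: hn; exists h => // j.
    by rewrite leNgt; apply/negP => ?; apply: hj; exists j.
  apply: le_trans (sqr_coord_le_dotp _ j).
  rewrite -[leRHS]real_normK ?num_real// ler_pXn2r ?nnegrE ?(ltW eta0)//.
  rewrite mxE; move: (_ j ord0) (b j ord0) (hb j) hj => x y hy hx.
  have := lerB_normD x y; rewrite /eta; lra.
have z0 : 0 < dotp z z by apply: lt_le_trans zz; rewrite exprn_gt0.
have [h ah [_ hz]] := contrast_direction i z.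
(* the corner of the box at which <z, .> is least *)
pose b : 'cV[R]_n := \col_j (- gamma0 * Num.sg (z j ord0)).
have : dotp z z <= dotp z (A^T *m h - basis_vec i + b).
  apply: zmin; exists h, b; split => // j.
  rewrite mxE normrM normrN (ger0_norm gg) normr_sg ler_piMr//.
  by case: (_ != 0); rewrite ?lexx ?ler01.
rewrite dotpDr (_ : dotp z b = - (gamma0 * \sum_j `|z j ord0|)); last first.
  rewrite mulr_sumr -sumrN; apply: eq_bigr => j _.
  by rewrite mxE [`|_|]normrEsg; ring.
move: z0 hz; lra.
Qed.

End contrast.

(** * Norms and the error of the recoveries *)

Section norms.
Context {R : realType}.
Variable n : nat.
Implicit Types v x z : 'cV[R]_n.

Definition l1norm v : R := \sum_i `|v i ord0|.

Lemma lpnorm1E v : lpnorm 1 v = l1norm v.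
Proof.
rewrite /lpnorm invr1 powRr1; last by apply: sumr_ge0 => i _; exact: powR_ge0.
by apply: eq_bigr => i _; rewrite powRr1.
Qed.

Lemma l1norm_ge0 v : 0 <= l1norm v. Proof. exact: sumr_ge0. Qed.

Lemma coord_le_norm v i : `|v i ord0| <= `|v|.
Proof.
rewrite [leRHS]/Num.norm/= mx_normrE.
by apply: (le_bigmax _ (fun ij : 'I_n * 'I_1 => `|v ij.1 ij.2|) (i, ord0)).
Qed.

Lemma norm_le_coord v (M : R) :
  0 <= M -> (forall i, `|v i ord0| <= M) -> `|v| <= M.
Proof.
move=> M0 vM; rewrite [leLHS]/Num.norm/= mx_normrE.
by apply: bigmax_le => // -[i j] _ /=; rewrite (ord1 j).
Qed.

Lemma dotp_le_l1 (c x : 'cV[R]_n) (g : R) :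
  (forall j, `|c j ord0| <= g) -> `|dotp c x| <= g * l1norm x.
Proof.
move=> cg; rewrite (le_trans (ler_norm_sum _ _ _))// mulr_sumr.
by apply: ler_sum => j _; rewrite normrM ler_wpM2r.
Qed.

(** From |z_i|^p <= |z_i| D^(p - 1). *)
Lemma lp_interpolation z (s D : R) (p : \bar R) :
  (1 <= p)%E -> 0 <= s -> `|z| <= D -> l1norm z <= s * D ->
  lpnorm p z <= s `^ fine p^-1 * D.
Proof.
case: p => [p| |//] p1 s0 zD z1; last first.
  by rewrite /lpnorm invey powRr0 mul1r.
rewrite lee_fin in p1.
have p0 : 0 < p by exact: lt_le_trans p1.
have D0 : 0 <= D by exact: le_trans zD.
rewrite /lpnorm inver gt_eqF//= -[X in _ * X]powRr1//.
rewrite -[X in D `^ X](@mulfV _ p) ?gt_eqF// powRrM -powRM ?powR_ge0//.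
apply: ge0_ler_powR; rewrite ?nnegrE ?invr_ge0 ?(ltW p0)//.
- by apply: sumr_ge0 => i _; exact: powR_ge0.
- by rewrite mulr_ge0// powR_ge0.
rewrite -mulr_powRB1// mulrA.
apply: (@le_trans _ _ (l1norm z * D `^ (p - 1))); last first.
  by rewrite ler_wpM2r// powR_ge0.
rewrite mulr_suml; apply: ler_sum => i _.
rewrite -mulr_powRB1// ler_wpM2l//; apply: ge0_ler_powR; rewrite ?nnegrE//.
  by rewrite subr_ge0.
exact: le_trans (coord_le_norm z i) zD.
Qed.

(** The relation prec that defines top_entries is a strict total order, so
    ranks are pairwise distinct and at most s of them are below s. *)
Lemma near_sparse_support (s : nat) (u : R) x : near_sparse s u x ->
  exists2 I : {set 'I_n}, (#|I| <= s)%N & \sum_(j | j \notin I) `|x j ord0| <= u.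
Proof.
move=> xu; have {xu} : lpnorm 1 (x - top_entries s x) <= u by exact: xu.
rewrite lpnorm1E => xu.
pose prec (i j : 'I_n) := (`|x i ord0| < `|x j ord0|)
  || (`|x j ord0| == `|x i ord0|) && (j < i)%N.
pose rank i := #|[pred j : 'I_n | prec i j]|.
exists (finset (fun i => (rank i < s)%N)); last first.
  apply: le_trans xu; rewrite big_mkcond/=; apply: ler_sum => j _.
  rewrite !mxE inE -/(prec j) -/(rank j).
  by case: (rank j < s)%N; rewrite /= ?subr0 ?subrr ?normr0.
have prec_trans i j k : prec i j -> prec j k -> prec i k.
  rewrite /prec => /orP[ij|/andP[/eqP ij ji]] /orP[jk|/andP[/eqP jk kj]].
  - by rewrite (lt_trans ij jk).
  - by rewrite jk ij.
  - by rewrite -ij jk.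
  - by rewrite jk ij eqxx (ltn_trans kj ji) orbT.
have precN i : prec i i = false by rewrite /prec ltxx ltnn andbF.
have rank_lt i j : prec i j -> (rank j < rank i)%N.
  move=> ij; apply: proper_card; apply/properP; split.
    by apply/fintype.subsetP => k; rewrite !inE => /(prec_trans _ _ _ ij).
  by exists j; rewrite !inE ?precN.
have rank_inj : injective rank.
  move=> i j rij; apply/eqP; apply: contraT => ij.
  have : prec i j || prec j i.
    rewrite /prec; case: (ltgtP `|x i ord0| `|x j ord0|) => //= _.
    by rewrite -neq_ltn eq_sym.
  by move=> /orP[] /rank_lt; rewrite rij ltnn.
rewrite cardE -(size_map rank) -[leqRHS](size_iota 0).
apply: uniq_leq_size; first by rewrite map_inj_uniq// enum_uniq.
by move=> k /mapP[i]; rewrite mem_enum inE mem_iota => ri ->.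
Qed.

(** On I the triangle inequality bounds |x_j| by |xh_j| and the error, off I it
    bounds the error by |x_j| and |xh_j|. *)
Lemma l1norm_cone x xh (I : {set 'I_n}) :
  l1norm (xh - x) + l1norm x <= 2 * \sum_(j in I) `|(xh - x) j ord0| +
     2 * \sum_(j | j \notin I) `|x j ord0| + l1norm xh.
Proof.
rewrite /l1norm !(bigID (mem I) predT)/=.
set a := \sum_(j in I) `|(xh - x) j ord0|.
set b := \sum_(j in I) `|x j ord0|.
set c := \sum_(j in I) `|xh j ord0|.
set a' := \sum_(j | _) `|(xh - x) j ord0|.
set b' := \sum_(j | _) `|x j ord0|.
set c' := \sum_(j | _) `|xh j ord0|.
have h1 : b <= a + c.
  rewrite -big_split/=; apply: ler_sum => j _.
  rewrite !mxE; have := ler_normB (xh j ord0) (xh j ord0 - x j ord0).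
  by rewrite subKr; lra.
have h2 : a' <= b' + c'.
  rewrite -big_split/=; apply: ler_sum => j _.
  by rewrite !mxE; have := ler_normB (xh j ord0) (x j ord0); lra.
lra.
Qed.

End norms.

Section recovery.
Context {R : realType}.
Variables (m n : nat) (A H : 'M[R]_(m, n)) (s : nat).
Hypotheses (s0 : (0 < s)%N) (cH : condH A s (1 / 4) H).

(** The inequality assumed here holds for both recoveries: the regular one
    satisfies l1norm xh <= l1norm x and |H^T A z| <= 2 V separately. *)
Lemma recovery_error (x xh : 'cV[R]_n) (V ups : R) :
  near_sparse s ups x -> 0 <= V ->
  l1norm xh + 2 * s%:R * `|H^T *m A *m (xh - x)| <= l1norm x + 4 * s%:R * V ->
  l1norm (xh - x) <= s%:R * (8 * V + 4 * ups / s%:R) /\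
  `|xh - x| <= 8 * V + 4 * ups / s%:R.
Proof.
move=> /near_sparse_support[I Is xI] V0 hmin.
have ups0 : 0 <= ups by apply: le_trans xI; exact: sumr_ge0.
have sp : 0 < s%:R :> R by rewrite ltr0n.
have := cH (xh - x); rewrite lpnorm1E /lpnorm.
have := l1norm_cone x xh I.
have : \sum_(j in I) `|(xh - x) j ord0| <= s%:R * `|xh - x|.
  apply: (@le_trans _ _ (#|I|%:R * `|xh - x|)).
    by rewrite mulr_natl -sumr_const; apply: ler_sum => j _; exact: coord_le_norm.
  by rewrite ler_wpM2r// ler_nat.
move: hmin xI.
set Q := `|H^T *m _ *m _|; set N := l1norm (xh - x); set M := `|xh - x|.
have : l1norm x <= l1norm xh + N.
  rewrite -big_split/=; apply: ler_sum => j _; rewrite !mxE.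
  by have := ler_normB (xh j ord0) (xh j ord0 - x j ord0); rewrite subKr.
set a := \sum_(j in I) _; set b := \sum_(j | j \notin I) _.
move: (l1norm x) (l1norm xh) => lx lxh.
have : 0 <= N by exact: l1norm_ge0.
have : 0 <= Q by exact: normr_ge0.
move: Q N M a b => Q N M a b Q0 N0 tri hmin xI aM cone hM.
have {}hM : s%:R * M <= s%:R * Q + N / 4.
  apply: (le_trans (ler_wpM2l (ltW sp) hM)).
  by rewrite le_eqVlt; apply/predU1P; left; field; rewrite gt_eqF.
have NV : N <= 8 * (s%:R * V) + 4 * ups by lra.
have MV : s%:R * M <= 8 * (s%:R * V) + 4 * ups by lra.
have e : s%:R * (8 * V + 4 * ups / s%:R) = 8 * (s%:R * V) + 4 * ups.
  by field; rewrite gt_eqF.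
by split; [rewrite e|rewrite -(ler_pM2l sp) e].
Qed.

End recovery.

(** * The contrast matrix and the risk *)

(** Union bound: at this threshold each of the n deviations has probability at
    most eps / n. *)
Lemma noise_event (R : realType) (m n : nat) (h : 'I_n -> 'cV[R]_m) (eps : R) :
  (0 < n)%N -> 0 < eps -> eps < 1 ->
  (Prob_gauss [set e | exists i,
     (Num.sqrt (2 * ln (n%:R / eps)) * enorm (h i) < `|dotp (h i) e|)%R]
   <= eps%:E)%E.
Proof.
move=> n0 eps0 eps1.
set l := Num.sqrt _.
have n1 : (1 : R) <= n%:R by rewrite ler1n.
have np : (0 : R) < n%:R by rewrite ltr0n.
have ne : 1 < n%:R / eps by rewrite ltr_pdivlMr// mul1r (lt_le_trans eps1).
have l0 : 0 < l by rewrite sqrtr_gt0 mulr_gt0// ln_gt0.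
have l2 : l ^+ 2 = 2 * ln (n%:R / eps).
  by rewrite sqr_sqrtr// mulr_ge0// ltW// ln_gt0.
pose E i := [set t : m.-tuple (measurableTypeR R) |
  l * enorm (h i) < `|\sum_j h i j ord0 * tnth t j|].
have mE i : measurable (E i).
  exact: (measurable_std_gaussian_tail (fun j => h i j ord0)).
have El i : (std_gaussian m (E i) <= (eps / n%:R)%:E)%E.
  have [h0|h0] := eqVneq (enorm (h i)) 0.
    rewrite (_ : E i = set0) ?measure0 ?lee_fin ?divr_ge0 ?ltW//.
    apply/seteqP; split => // t; rewrite /E/= h0 mulr0 big1 ?normr0 ?ltxx//.
    by move=> j _; rewrite (enorm_eq0 h0) mxE mul0r.
  have hp : 0 < enorm (h i) by rewrite lt0r h0 enorm_ge0.
  pose c j := l / enorm (h i) * h i j ord0.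
  have c2 : \sum_j c j ^+ 2 = l ^+ 2.
    rewrite (eq_bigr (fun j => (l / enorm (h i)) ^+ 2 * (h i j ord0 * h i j ord0))).
      by rewrite -mulr_sumr -/(dotp _ _) -sqr_enorm -exprMn divfK.
    by move=> j _; rewrite /c exprMn expr2.
  have := std_gaussian_tail c; rewrite c2.
  rewrite (_ : expR _ = eps / n%:R); last first.
    rewrite l2 mulNr [2 * _]mulrC mulfK// -lnV ?posrE ?(lt_trans _ ne)// lnK.
      by rewrite invf_div.
    by rewrite posrE invr_gt0 (lt_trans _ ne).
  rewrite (_ : [set t | _] = E i)//; apply: eq_set => t /=.
  rewrite (eq_bigr (fun j => l / enorm (h i) * (h i j ord0 * tnth t j))); last first.
    by move=> j _; rewrite mulrA.
  rewrite -mulr_sumr normrM [`|l / _|]ger0_norm ?divr_ge0 ?ltW//.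
  by rewrite expr2 -mulrA ltr_pM2l// mulrC ltr_pdivlMr// mulrC.
have bE (r : seq 'I_n) : measurable (\big[setU/set0]_(i <- r) E i) /\
    (std_gaussian m (\big[setU/set0]_(i <- r) E i) <=
     ((size r)%:R * (eps / n%:R))%:E)%E.
  elim: r => [|i r [mr IHr]]; first by rewrite big_nil measure0 mul0r.
  rewrite big_cons; split; first exact: measurableU.
  apply: (le_trans (measureU2 _ (mE i) mr)).
  by rewrite /= -natr1 mulrDl mul1r addrC EFinD leeD.
have [mF Fl] := bE (index_enum 'I_n).
rewrite /Prob_gauss.
apply: (@le_trans _ _ (mu_ext (std_gaussian m)
    (\big[setU/set0]_(i <- index_enum 'I_n) E i))).
  apply: le_mu_ext => t [i hi]; rewrite -bigcup_seq; exists i => //=.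
    exact: mem_index_enum.
  rewrite /E/=; move: hi; congr (_ < `|_|).
  by apply: eq_bigr => j _; rewrite mxE.
rewrite measurable_mu_extE//; apply: (le_trans Fl).
by rewrite lee_fin -[index_enum _]enumT size_enum_ord mulrC divfK ?gt_eqF.
Qed.

Section contrast_matrix.
Context {R : realType}.
Variables (m n : nat) (A : 'M[R]_(m, n)).

Lemma mulmx_trE (H : 'M[R]_(m, n)) (y : 'cV[R]_m) i :
  (H^T *m y) i ord0 = dotp (col i H) y.
Proof. by rewrite mxE; apply: eq_bigr => k _; rewrite !mxE. Qed.

(** x_i is <A^T h_i, x> up to the error <A^T h_i - e_i, x>, and the first term
    is the i-th entry of H^T A x. *)
Lemma contrast_condH (s : nat) (H : 'M[R]_(m, n)) : (0 < s)%N ->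
  (forall i j, `|(A^T *m col i H - basis_vec i) j ord0| <= 1 / (4 * s%:R)) ->
  condH A s (1 / 4) H.
Proof.
move=> s0 hH x; rewrite lpnorm1E /lpnorm.
have sp : 0 < s%:R :> R by rewrite ltr0n.
apply: norm_le_coord => [|i].
  by rewrite addr_ge0// mulr_ge0 ?l1norm_ge0// mulr_ge0// invr_ge0 ltW.
have := coord_le_norm (H^T *m A *m x) i.
rewrite -mulmxA mulmx_trE dotp_mulmx.
have := dotp_le_l1 x (hH i); rewrite dotpBl dotp_basisl.
rewrite (_ : s%:R^-1 * (1 / 4) = 1 / (4 * s%:R)); last first.
  by field; rewrite gt_eqF.
set a := dotp _ x => h1 h2.
have := ler_normB a (a - x i ord0); rewrite subKr; lra.
Qed.

Variables (U : set 'cV[R]_m) (sigma eps : R).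
Hypotheses (sigma0 : 0 < sigma) (hU : uncertainty_set U).

Lemma has_ubound_dotp (h : 'cV[R]_m) : has_ubound [set dotp u h | u in U].
Proof.
case: hU => _ _ /compact_bounded[M [Mr hM]] _.
exists ((M + 1) * l1norm h) => _ [u Uu <-].
apply: le_trans (ler_norm _) _; apply: dotp_le_l1 => j.
apply: (le_trans (coord_le_norm u j)).
by apply: hM => //; rewrite ltrDl.
Qed.

Lemma perturbation_le_nu (h u xi : 'cV[R]_m) : U u ->
  `|dotp h xi| <= Num.sqrt (2 * ln (n%:R / eps)) * enorm h ->
  `|dotp h (sigma *: xi + u)| <= nu n U sigma eps h.
Proof.
move=> Uu hxi; case: (hU) => _ _ _ symU.
rewrite dotpDr dotpZr (le_trans (ler_normD _ _))// addrC /nu lpnorm2E.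
apply: lerD.
  have ub := ub_le_sup (has_ubound_dotp h).
  rewrite ler_norml lerNl -dotpNr !(dotpC h).
  apply/andP; split; apply: ub; last by exists u.
  by exists (- u) => //; exact: symU.
by rewrite normrM gtr0_norm// -mulrA ler_wpM2l// ltW.
Qed.

Lemma col_le_nu_mx (H : 'M[R]_(m, n)) i :
  nu n U sigma eps (col i H) <= nu_mx U sigma eps H.
Proof. exact: (le_bigmax _ (fun i => nu n U sigma eps (col i H))). Qed.

Lemma nu_mx_ge0 (H : 'M[R]_(m, n)) : 0 <= nu_mx U sigma eps H.
Proof. exact: bigmax_ge_id. Qed.

(** Off the noise event x is feasible for the regular problem, and its residual
    H^T (A x - y) is at most V = nu(H) for the penalized one; comparing the
    recovery with x then gives the inequality that recovery_error needs. *)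
Lemma recovery_optimality (H : 'M[R]_(m, n)) (s : nat) xhat x (eta : 'cV[R]_m) :
  regular_recovery A H (fun i => nu n U sigma eps (col i H)) xhat
    \/ penalized_recovery A H s 2 xhat ->
  (forall i, `|dotp (col i H) eta| <= nu n U sigma eps (col i H)) ->
  l1norm (xhat (A *m x + eta)) +
    2 * s%:R * `|H^T *m A *m (xhat (A *m x + eta) - x)| <=
  l1norm x + 4 * s%:R * nu_mx U sigma eps H.
Proof.
set y := A *m x + eta; set V := nu_mx _ _ _ _ => rec good.
have V0 : 0 <= V by exact: nu_mx_ge0.
have goodV i : `|dotp (col i H) (A *m x - y)| <= nu n U sigma eps (col i H).
  by rewrite /y opprD addrA subrr add0r dotpNr normrN.
have zE i : (H^T *m A *m (xhat y - x)) i ord0 =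
    dotp (col i H) (A *m xhat y - y) - dotp (col i H) (A *m x - y).
  by rewrite -mulmxA mulmx_trE mulmxBr -dotpBr opprB addrA subrK.
case: rec => [[_ /(_ y)] | [_ /(_ y)]].
  move=> /(_ (ex_intro _ x goodV))[feas /(_ x goodV)].
  rewrite !lpnorm1E => hl1.
  have : `|H^T *m A *m (xhat y - x)| <= 2 * V.
    apply: norm_le_coord => [|i]; first by rewrite mulr_ge0.
    rewrite zE (le_trans (ler_normB _ _))//.
    by have := col_le_nu_mx H i; have := goodV i; have := feas i; rewrite -/V; lra.
  move=> /(ler_wpM2l (_ : 0 <= 2 * s%:R)) => /(_ (mulr_ge0 (ler0n _ _) (ler0n _ _))).
  lra.
move=> [_ /(_ x Logic.I)]; rewrite !lpnorm1E /lpnorm.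
set Qh := `|H^T *m (A *m xhat y - y)|; set Qx := `|H^T *m (A *m x - y)|.
have hQx : Qx <= V.
  apply: norm_le_coord => // i; rewrite mulmx_trE.
  exact: le_trans (goodV i) (col_le_nu_mx H i).
have hQ : `|H^T *m A *m (xhat y - x)| <= Qh + V.
  apply: norm_le_coord => [|i]; first by rewrite addr_ge0 ?normr_ge0.
  rewrite zE (le_trans (ler_normB _ _))// lerD//.
    by rewrite -mulmx_trE coord_le_norm.
  exact: le_trans (goodV i) (col_le_nu_mx H i).
have s2 : 0 <= 2 * s%:R :> R by rewrite mulr_ge0.
have := ler_wpM2l s2 hQ; have := ler_wpM2l s2 hQx; lra.
Qed.

End contrast_matrix.


Theorem proposition6 (R : realType) (m n : nat) (A : 'M[R]_(m, n))
    (eps sigma : R) (U : set 'cV[R]_m) (S : nat) (omega : R) :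
  0 < eps -> eps < 1 / 16 -> 0 < sigma -> uncertainty_set U ->
  (1 <= S)%N -> (S <= n)%N -> 0 < omega ->
  condO A U sigma eps S omega ->
  forall s : nat, (1 <= s)%N ->
  s%:R * (4 * omega * max_singular_value A)
    <= sigma * Num.sqrt (2 * S%:R * ln (1 / eps)) ->
  (exists H : 'M[R]_(m, n),
    [/\ condH A s (1 / 4) H,
        nu_mx U sigma eps H
          <= 2 * Num.sqrt (1 + ln n%:R / ln (1 / eps)) * omega
      & forall (p : \bar R) (upsilon : R), (1 <= p)%E -> 0 <= upsilon ->
        forall xhat : 'cV[R]_m -> 'cV[R]_n,
          regular_recovery A H (fun i => nu n U sigma eps (col i H)) xhat
          \/ penalized_recovery A H s 2 xhat ->
          (risk A U p xhat eps sigma s upsilon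
           <= (16 * s%:R `^ (fine p^-1)
               * (omega * Num.sqrt (1 + ln n%:R / ln (1 / eps))
                  + upsilon / (4 * s%:R)))%:E)%E]) /\
  (omega_star A U sigma eps (1 / (4 * s%:R))
   <= (2 * Num.sqrt (1 + ln n%:R / ln (1 / eps)) * omega)%:E)%E.
Proof.
move=> eps0 eps16 sigma0 hU S0 Sn omega0 hO s s0 hs.
have n0 : (0 < n)%N by exact: leq_trans Sn.
have sp : 0 < s%:R :> R by rewrite ltr0n.
set rho := Num.sqrt _.
have rho0 : 0 <= rho by exact: sqrtr_ge0.
have /choice[h hP] (i : 'I_n) : exists h, admissible U sigma eps omega h /\
    forall j, `|(A^T *m h - basis_vec i) j ord0| <= 1 / (4 * s%:R).
  have [h ah hh] :=
    contrast_exists eps0 eps16 sigma0 omega0 hU n0 S0 Sn s0 hO hs i.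
  by exists h.
have hnu i : nu n U sigma eps (h i) <= 2 * rho * omega.
  exact: (admissible_nu eps0 eps16 hU n0 (hP i).1).
have M0 : 0 <= 2 * rho * omega by rewrite !mulr_ge0// ltW.
split; last first.
  apply: bigmax_le => [|i _]; first by rewrite leNye.
  apply: (@le_trans _ _ (nu n U sigma eps (h i))%:E); last by rewrite lee_fin.
  apply: ereal_inf_lbound; exists (h i) => //=.
  apply: norm_le_coord; last exact: (hP i).2.
  by rewrite divr_ge0// mulr_ge0// ltW.
pose H : 'M[R]_(m, n) := \matrix_(a, i) h i a ord0.
have colH i : col i H = h i by apply/colP => a; rewrite !mxE.
have cH : condH A s (1 / 4) H.
  by apply: contrast_condH => // i j; rewrite colH; exact: (hP i).2.
have hV : nu_mx U sigma eps H <= 2 * rho * omega.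
  by apply: bigmax_le => // i _; rewrite colH.
exists H; split => // p ups p1 ups0 xhat rec.
apply: ereal_inf_lbound; eexists; last by [].
have eps1 : eps < 1 by lra.
apply: le_trans (noise_event h n0 eps0 eps1); rewrite /Prob_gauss.
apply: le_mu_ext => t; rewrite /preimage/=; set xi := tuple_col t.
move=> [x [u [xs Uu]]]; apply: contraPP => noise.
apply/negP; rewrite -leNgt.
have good i : `|dotp (col i H) (sigma *: xi + u)| <= nu n U sigma eps (col i H).
  apply: perturbation_le_nu => //; rewrite colH leNgt; apply/negP => hi.
  by apply: noise; exists i.
rewrite -addrA.
have := recovery_optimality x rec good.
move=> /(recovery_error s0 cH xs (nu_mx_ge0 U sigma eps H)).
set z := xhat _ - x; set V := nu_mx _ _ _ _; set D := 8 * V + _.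
move=> [z1 zoo].
apply: (le_trans (lp_interpolation p1 (ltW sp) zoo z1)).
rewrite [16 * _]mulrC -mulrA ler_wpM2l ?powR_ge0//.
rewrite mulrDr (_ : 16 * (ups / _) = 4 * ups / s%:R); last first.
  by field; rewrite gt_eqF.
by rewrite lerD2r; move: hV; rewrite -/V; lra.
Qed.
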